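(* Assume that $c(x,\cdot)\in C^1(\mathcal Y)$ for every $x$ and that $$\nabla\psi_\varepsilon^\nu(y)=-\int_{\mathcal X}\nabla_2c(x,y)\,\pi_\varepsilon^\nu(dx|y)$$ holds in the sense of weak derivatives, $\nu$-a.e. Let $\pi^\nu_\varepsilon$ and $\pi^\mu_\varepsilon$ be the unique optimizers of the entropic optimal transport problem for the pairs of marginals $(\rho,\nu)$ and $(\rho,\mu)$ respectively. If there exist $\Lambda>0$ and a non-negative function $\omega:\mathcal Y\times\mathcal Y\to\mathbb R$ such that $y\mapsto c(x,y)+\psi^\nu_\varepsilon(y)$ is $(\Lambda,\omega)$-semiconcave uniformly in $x\in\mathrm{supp}(\rho)$, then $$\mathscr H(\pi^\mu_\varepsilon|\pi^\nu_\varepsilon)\le \mathscr H(\mu|\nu)+\frac{\Lambda}{2\varepsilon}\,\mathbf W_\omega(\mu,\nu).$$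
   Context: $\mathcal X$ is a Polish space; $(\mathcal Y,\mathfrak g)$ is a (possibly unbounded) connected Riemannian manifold without boundary with Riemannian distance $\mathsf d$. $\rho\in\mathcal P(\mathcal X)$, $\nu,\mu\in\mathcal P(\mathcal Y)$ are probability measures, $c:\mathcal X\times\mathcal Y\to\mathbb R$ is a cost and $\varepsilon>0$. $\nabla_2$ denotes the gradient in the second variable. $\Pi(\cdot,\cdot)$ is the set of couplings and $\mathscr H(p|q)=\int\log\frac{dp}{dq}\,dp$ (equal to $+\infty$ if $p\not\ll q$) is the relative entropy. For non-negative $\omega$, $\mathbf W_\omega(\mu,\nu)=\inf_{\pi\in\Pi(\mu,\nu)}\int_{\mathcal Y\times\mathcal Y}\omega(z,y)\,d\pi(z,y)$. The entropic optimal transport problem for marginals $(\rho,\nu)$ is $\inf_{\pi\in\Pi(\rho,\nu)}\int c\,d\pi+\varepsilon\mathscr H(\pi|\rho\otimes\nu)$. Throughout, the cost satisfies mild integrability conditions ensuring that (for each pair of marginals considered) the unique optimal plan $\pi^\nu_\varepsilon$ satisfies $$\frac{d\pi_\varepsilon^\nu}{d(\rho\otimes\nu)}(x,y)=\exp\Big(-\frac{c(x,y)+\varphi^\nu_\varepsilon(x)+\psi^\nu_\varepsilon(y)}{\varepsilon}\Big)\quad \rho\otimes\nu\text{-a.e.}$$ for some functions $\varphi^\nu_\varepsilon,\psi^\nu_\varepsilon$ (entropic potentials). They are extended everywhere, with values in $\mathbb R\cup\{+\infty\}$, so that the Schrödinger system holds everywhere: $\varphi^\nu_\varepsilon(x)=\varepsilon\log\int_{\mathcal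 Y}e^{-(c(x,y)+\psi^\nu_\varepsilon(y))/\varepsilon}\nu(dy)$ and $\psi^\nu_\varepsilon(y)=\varepsilon\log\int_{\mathcal X}e^{-(c(x,y)+\varphi^\nu_\varepsilon(x))/\varepsilon}\rho(dx)$. The conditional law is $\pi^\nu_\varepsilon(dx|y)=\exp\big(-\frac{c(x,y)+\varphi^\nu_\varepsilon(x)+\psi^\nu_\varepsilon(y)}{\varepsilon}\big)\rho(dx)$. Analogous notation is used with $\mu$ in place of $\nu$. A differentiable $f:\mathcal Y\to\mathbb R$ is $(\Lambda,\omega)$-semiconcave if for all $z,y\in\mathcal Y$ and any geodesic $(\gamma_t)_{t\in[0,1]}$ with $\gamma_0=y$, $\gamma_1=z$, $$f(z)-f(y)\le\langle\nabla f(y),\dot\gamma_0\rangle_{\mathfrak g}+\frac{\Lambda}{2}\omega(z,y).$$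
   Formalization: Any two points of Y are assumed joined by a minimizing geodesic (true if Y is complete); else semiconcavity can be vacuous and the claim fails, e.g. on the punctured plane. The weak gradient of ψ is taken as its classical gradient wherever ψ is differentiable. *)

(* Defs.v *)
From HB Require Import structures.
From mathcomp Require Import all_boot all_order all_algebra.
From mathcomp Require Import all_classical all_reals all_analysis.
From mathcomp Require Import measurable_realfun.

Set Implicit Arguments.
Unset Strict Implicit.
Unset Printing Implicit Defensive.

Import Order.TTheory GRing.Theory Num.Theory.
Import numFieldNormedType.Exports.

Local Open Scope classical_set_scope.
Local Open Scope ring_scope.

(** * Measure theory *)

(* A topological space with its Borel sigma-algebra. *)
Notation borel T := (g_sigma_algebraType (@open T)).

Definition polish_space (R : realType) (X : topologicalType) : Prop :=
  (exists2 D : set X, countable D & dense D) /\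
  exists d : X -> X -> R,
    [/\ forall x y, d x y = 0 <-> x = y,
        forall x y, d x y = d y x,
        forall x y z, d x z <= d x y + d y z,
        (* [d] induces the topology of [X] *)
        forall x, nbhs x =
          filter_from [set e : R | 0 < e] (fun e => [set y | d x y < e]) &
        (* [d] is complete *)
        forall u : nat -> X,
          (forall e : R, 0 < e -> exists N : nat, forall m n : nat,
             (N <= m)%N -> (N <= n)%N -> d (u m) (u n) < e) ->
          exists l : X, u @ \oo --> l].

Section measures.
Context {R : realType}.
Local Open Scope ereal_scope.

Definition supp (T : ptopologicalType) (m : probability (borel T) R) : set T :=
  [set x | forall U : set T, open U -> U x -> 0 < m U].

Definition coupling d1 d2 (T1 : measurableType d1) (T2 : measurableType d2)
    (m1 : probability T1 R) (m2 : probability T2 R) :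
    set (probability (T1 * T2)%type R) :=
  [set p | (forall A, measurable A -> p (A `*` setT) = m1 A) /\
           (forall B, measurable B -> p (setT `*` B) = m2 B)].

Definition density d (T : measurableType d) (p q : probability T R) :
    T -> \bar R :=
  Radon_Nikodym (charge_of_finite_measure p) q.

Definition rel_entropy d (T : measurableType d) (p q : probability T R) :
    \bar R :=
  if `[< p `<< q >] then
    \int[p]_x lne (density p q x)
  else +oo.

Definition transport_cost d (T : measurableType d) (w : T -> T -> R)
    (m1 m2 : probability T R) : \bar R :=
  ereal_inf [set \int[p]_a (w a.1 a.2)%:E | p in coupling m1 m2].

End measures.

(** * Entropic optimal transport *)

Section entropic_optimal_transport.
Context {R : realType} {d1 d2 : measure_display}.
Context {X : measurableType d1} {Y : measurableType d2}.
Variables (c : X -> Y -> R) (eps : R).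
Variables (rho : probability X R) (nu : probability Y R).
Local Open Scope ereal_scope.

(* The objective is [+oo] when [c] is not integrable, which avoids the
   indeterminate form [oo - oo]. *)
Definition eot_value (p : probability (X * Y)%type R) : \bar R :=
  if `[< p.-integrable setT (fun a => (c a.1 a.2)%:E) >] then
    \int[p]_a (c a.1 a.2)%:E + eps%:E * rel_entropy p (rho \x nu)
  else +oo.

Definition unique_eot_plan (p : probability (X * Y)%type R) : Prop :=
  [/\ coupling rho nu p,
      forall q, coupling rho nu q -> eot_value p <= eot_value q &
      forall q, coupling rho nu q -> eot_value q <= eot_value p ->
        forall A, measurable A -> q A = p A].

Definition gibbs_density (phi : X -> \bar R) (psi : Y -> \bar R)
    (x : X) (y : Y) : \bar R :=
  expeR (- (((c x y)%:E + phi x + psi y) * (eps^-1)%:E)).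

Definition entropic_potentials (p : probability (X * Y)%type R)
    (phi : X -> \bar R) (psi : Y -> \bar R) : Prop :=
  [/\ [/\ measurable_fun setT phi, measurable_fun setT psi,
          forall x, phi x != -oo & forall y, psi y != -oo],
      p `<< (rho \x nu),
      {ae (rho \x nu), forall a,
        density p (rho \x nu) a = gibbs_density phi psi a.1 a.2},
      forall x, phi x = eps%:E *
        lne (\int[nu]_y expeR (- (((c x y)%:E + psi y) * (eps^-1)%:E))) &
      forall y, psi y = eps%:E *
        lne (\int[rho]_x expeR (- (((c x y)%:E + phi x) * (eps^-1)%:E)))].

End entropic_optimal_transport.

(** * Riemannian manifolds *)

Section calculus.
Context {R : realType} {n : nat}.

Definition partial (i : 'I_n) (f : 'rV[R]_n -> R) : 'rV[R]_n -> R :=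
  fun u => 'D_(delta_mx ord0 i) f u.

(* [f] is of class [C^k] on the open set [U]. *)
Fixpoint Ck (k : nat) (U : set 'rV[R]_n) (f : 'rV[R]_n -> R) : Prop :=
  (forall u, U u -> {for u, continuous f}) /\
  match k with
  | 0%N => True
  | k'.+1 => forall i : 'I_n,
      (forall u, U u -> derivable f u (delta_mx ord0 i)) /\
      Ck k' U (partial i f)
  end.

Definition smooth (U : set 'rV[R]_n) (f : 'rV[R]_n -> R) : Prop :=
  forall k, Ck k U f.

End calculus.

(* The [n]-dimensional Lebesgue measure, on tuples because these carry the
   product sigma-algebra. *)
Fixpoint lebesgue_tuple (R : realType) (n : nat) :
    set (n.-tuple (measurableTypeR R)) -> \bar R :=
  match n with
  | 0%N => dirac [tuple]
  | m.+1 => pushforward (lebesgue_measure \x @lebesgue_tuple R m)%E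
              (fun p => cons_tuple p.1 p.2)
  end.

Definition row_of_tuple (R : realType) (n : nat)
    (t : n.-tuple (measurableTypeR R)) : 'rV[R]_n := \row_i tnth t i.

(* [gram a y] is the Gram matrix of the metric at [y] in the basis of coordinate
   vectors of the chart [a]. The values of [chart a] and [gram a] outside
   [chart_dom a] are irrelevant, and so are those of [chart_inv a] outside the
   image of [chart_dom a]. *)
Record riemannian_manifold (R : realType) (n : nat) := RiemannianManifold {
  manifold_point :> ptopologicalType;
  manifold_hausdorff : hausdorff_space manifold_point;
  manifold_second_countable : @second_countable manifold_point;
  chart_index : Type;
  chart_dom : chart_index -> set manifold_point;
  chart : chart_index -> manifold_point -> 'rV[R]_n;
  chart_inv : chart_index -> 'rV[R]_n -> manifold_point;
  chart_dom_open : forall a, open (chart_dom a);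
  chart_image_open : forall a, open (chart a @` chart_dom a);
  chart_continuous : forall a y, chart_dom a y -> {for y, continuous (chart a)};
  chart_inv_continuous : forall a y, chart_dom a y ->
    {for chart a y, continuous (chart_inv a)};
  chartK : forall a y, chart_dom a y -> chart_inv a (chart a y) = y;
  chart_smooth : forall a b (j : 'I_n),
    smooth (chart a @` (chart_dom a `&` chart_dom b))
      (fun u => chart b (chart_inv a u) ord0 j);
  (* a chosen chart around each point *)
  chart_at : manifold_point -> chart_index;
  chart_at_dom : forall y, chart_dom (chart_at y) y;
  gram : chart_index -> manifold_point -> 'M[R]_n;
  gram_smooth : forall a (i j : 'I_n),
    smooth (chart a @` chart_dom a) (fun u => gram a (chart_inv a u) i j);
  gram_sym : forall a y, chart_dom a y -> (gram a y)^T = gram a y;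
  gram_pos : forall a y (v : 'rV[R]_n), chart_dom a y -> v != 0 ->
    0 < (v *m gram a y *m v^T) ord0 ord0;
  gram_compatible : forall a b y, chart_dom a y -> chart_dom b y ->
    let J := \matrix_(i < n, j < n)
      partial i (fun u => chart b (chart_inv a u) ord0 j) (chart a y) in
    gram a y = J *m gram b y *m J^T
}.

Section riemannian.
Context {R : realType} {n : nat}.
Variable M : riemannian_manifold R n.
Implicit Types (y z : M) (f : M -> R) (g : R -> M).

(* A tangent vector at [y] is represented by its coordinates in the chart
   [chart_at M y]. *)
Definition metric_tensor y (v w : 'rV[R]_n) : R :=
  (v *m gram (chart_at y) y *m w^T) ord0 ord0.

Definition in_chart (a : chart_index M) f : 'rV[R]_n -> R :=
  fun u => f (chart_inv a u).

Definition differentiable_at f y : Prop :=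
  differentiable (in_chart (chart_at y) f : 'rV[R]_n -> R^o)
    (chart (chart_at y) y).

Definition differential f y : 'rV[R]_n :=
  \row_i partial i (in_chart (chart_at y) f) (chart (chart_at y) y).

Definition gradient f y : 'rV[R]_n :=
  differential f y *m invmx (gram (chart_at y) y).

Definition C1 f : Prop :=
  forall a : chart_index M, Ck 1 (chart a @` chart_dom a) (in_chart a f).

Definition curve_in_chart (a : chart_index M) g : R -> 'rV[R]_n :=
  fun t => chart a (g t).

Definition C1_curve g : Prop :=
  continuous g /\
  forall (a : chart_index M) t, chart_dom a (g t) ->
    derivable (curve_in_chart a g) t 1 /\
    {for t, continuous (derive1 (curve_in_chart a g))}.

Definition velocity g (t : R) : 'rV[R]_n :=
  derive1 (curve_in_chart (chart_at (g t)) g) t.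

Definition curve_length g : R :=
  \int[lebesgue_measure]_(t in `[0, 1])
    Num.sqrt (metric_tensor (g t) (velocity g t) (velocity g t)).

(* Piecewise [C^1] curves give the same infimum, since they can be
   reparametrised so as to stop at the break points. *)
Definition riemannian_distance y z : R :=
  inf [set curve_length g | g in [set g | [/\ C1_curve g, g 0 = y & g 1 = z]]].

(* Constant-speed minimizing geodesics, parametrised by [0, 1]; the values of
   [g] outside [0, 1] are irrelevant. *)
Definition geodesic g : Prop :=
  forall s t, 0 <= s <= 1 -> 0 <= t <= 1 ->
    riemannian_distance (g s) (g t) =
      `|s - t| * riemannian_distance (g 0) (g 1).

Definition geodesically_connected : Prop :=
  forall y z, exists g, [/\ geodesic g, g 0 = y & g 1 = z].

(* Right derivative at time 0, because only the restriction of a geodesic to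
   [0, 1] is meaningful; the limit exists, minimizing geodesics being smooth. *)
Definition initial_velocity g : 'rV[R]_n :=
  lim ((h^-1 *: (curve_in_chart (chart_at (g 0)) g h
                 - curve_in_chart (chart_at (g 0)) g 0)) @[h --> 0^'+]).

Definition semiconcave (L : R) (w : M -> M -> R) f : Prop :=
  (forall y, differentiable_at f y) /\
  forall z y g, geodesic g -> g 0 = y -> g 1 = z ->
    f z - f y <= metric_tensor y (gradient f y) (initial_velocity g)
                 + L / 2 * w z y.

Definition chart_integrable (D : set 'rV[R]_n) (F : 'rV[R]_n -> R) : Prop :=
  (@lebesgue_tuple R n).-integrable
    [set t | D (row_of_tuple t)] (fun t => (F (row_of_tuple t))%:E).

Definition chart_integral (F : 'rV[R]_n -> R) : R :=
  fine (\int[@lebesgue_tuple R n]_t (F (row_of_tuple t))%:E)%E.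

Definition test_function (U : set 'rV[R]_n) (h : 'rV[R]_n -> R) : Prop :=
  smooth setT h /\
  exists K : set 'rV[R]_n,
    [/\ compact K, K `<=` U & forall u, ~ K u -> h u = 0].

(* The components in the chart [a] of the covector dual to the tangent vector
   [v] at [y]. *)
Definition covector (a : chart_index M) y (v : 'rV[R]_n) : 'rV[R]_n :=
  let J := \matrix_(i < n, j < n)
    partial i (fun u => chart a (chart_inv (chart_at y) u) ord0 j)
      (chart (chart_at y) y) in
  v *m J *m gram a y.

(* In every chart, the components of the covector field dual to [G] are locally
   integrable and are the distributional partial derivatives of [f]. *)
Definition weak_gradient f (G : M -> 'rV[R]_n) : Prop :=
  forall a : chart_index M,
    let U := chart a @` chart_dom a in
    let fa := in_chart a f in
    let Ga (i : 'I_n) u :=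
      covector a (chart_inv a u) (G (chart_inv a u)) ord0 i in
    (forall K : set 'rV[R]_n, compact K -> K `<=` U ->
       chart_integrable K fa /\ forall i, chart_integrable K (Ga i)) /\
    forall (i : 'I_n) h, test_function U h ->
      chart_integral (fun u => fa u * partial i h u) =
      - chart_integral (fun u => Ga i u * h u).

End riemannian.

(** * The gradient of the entropic potential *)

Section gradient_formula.
Context {R : realType} {X : ptopologicalType} {n : nat}.
Variables (M : riemannian_manifold R n) (c : X -> M -> R) (eps : R).
Variables (rho : probability (borel X) R) (nu : probability (borel M) R).
Variables (phi : X -> \bar R) (psi : M -> \bar R).

(* The conditional law of [x] given [y] is [gibbs_density x y * rho(dx)]. *)
Definition cond_density (y : M) (x : X) : R :=
  fine (gibbs_density (X := borel X) (Y := borel M) c eps phi psi x y).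

Definition cond_integrable_gradient (y : M) : Prop :=
  forall i : 'I_n, rho.-integrable setT
    (fun x => (gradient (c x) y ord0 i * cond_density y x)%:E).

Definition cond_mean_gradient (y : M) : 'rV[R]_n :=
  \row_i \int[rho]_x (gradient (c x) y ord0 i * cond_density y x).

(* A weak gradient is only determined up to sets of zero volume, which [nu] may
   charge: the representative [G] is the one that agrees with the gradient
   wherever [psi] is differentiable. *)
Definition weak_gradient_formula : Prop :=
  exists G : M -> 'rV[R]_n,
    [/\ weak_gradient (fine \o psi) G,
        forall y, differentiable_at (fine \o psi) y ->
          G y = gradient (fine \o psi) y &
        {ae nu, forall y : borel M,
          cond_integrable_gradient y /\ G y = - cond_mean_gradient y}].

End gradient_formula.

(* Main.v *)
Require Import Defs.
From HB Require Import structures.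
From mathcomp Require Import all_boot all_order all_algebra.
From mathcomp Require Import all_classical all_reals all_analysis.
From mathcomp Require Import measurable_realfun.
From mathcomp Require Import ring lra.

Set Implicit Arguments.
Unset Strict Implicit.
Unset Printing Implicit Defensive.

Import Order.TTheory GRing.Theory Num.Theory.
Import numFieldNormedType.Exports.

Local Open Scope classical_set_scope.
Local Open Scope ring_scope.

(** Write g for the Gibbs density of pi_nu with respect to rho \x nu. As
    psi_nu is finite everywhere, g(x,y) rho(dx) is a probability for every y: it
    is the conditional law pi_nu(dx|y). In the ratio of the two Gibbs densities
    the cost cancels, so pi_mu has density exp(s) g with respect to rho \x mu,
    where s(x,z) = a(x) + b(z), a = (phi_nu - phi_mu)/eps and
    b = (psi_nu - psi_mu)/eps. The chain rule [rel_entropy_chain_rule] then bounds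
    H(pi_mu|pi_nu) by H(mu|nu) + int s dpi_mu, and it remains to bound
    int s dpi_mu by (L / 2 eps) int w dtau for each coupling tau of mu and nu.

    The integral of s is the mean over z ~ mu of the relative entropy of
    pi_mu(dx|z) with respect to pi_nu(dx|z). The Donsker-Varadhan formula presents
    it as the supremum over al of
      int al drho - int ln (int exp(al) dpi_nu(.|z)) mu(dz),
    with optimal choice al = a; each value of this functional is transported
    from z to y along tau. Indeed g(x,z) = g(x,y) exp(-D/eps), where D is the
    increment from y to z of c(x,.) + psi_nu. Semiconcavity bounds D by
    the pairing of the gradient of c(x,.) + psi_nu at y with the initial
    velocity of a geodesic from y to z, plus (L/2) w(z,y); the mean of the pairing
    under pi_nu(dx|y) vanishes by the formula for the gradient of psi_nu.
    Jensen's inequality ([jensen_log_mgf]) therefore gives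
      int al dpi_nu(.|y) <= ln (int exp(al) dpi_nu(.|z)) + (L / 2 eps) w(z,y),
    and integrating against tau bounds the functional ([test_function_bound]).

    The functions a and b may fail to be integrable, and then int s dpi_mu does
    not split into an integral over rho and one over mu. The bound is therefore
    proved for bounded al only and applied to truncations a_n of a.
    With gam_n(z) = ln (int exp(a_n) dpi_nu(.|z)), the functions
    a_n(x) - gam_n(z) have lower limit at least s and are bounded below by
    -exp(-s) ([trunc_limit], [trunc_lower]). Since exp(-s) has integral 1 under
    pi_mu, Fatou's lemma transfers the bound to s ([integral_log_density_le]). *)

(** * Integrals against densities and couplings *)

Section integration.
Context {R : realType}.
Local Open Scope ereal_scope.

(** The integral of a non-negative function is the supremum of the integrals of
    the simple functions below it, so it is monotone on arbitrary functions. The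
    function that defines the transport cost is such a function. *)
Lemma ge0_le_integral_nomeas d (T : measurableType d)
    (m : {measure set T -> \bar R}) (f1 f2 : T -> \bar R) :
  (forall x, 0 <= f1 x) -> (forall x, f1 x <= f2 x) ->
  \int[m]_x f1 x <= \int[m]_x f2 x.
Proof.
move=> f10 f12; rewrite !ge0_integralTE //; last first.
  by move=> x; exact: le_trans (f12 x).
apply: le_ereal_sup => _ [h /= hf <-]; exists h => //= x.
exact: le_trans (f12 x).
Qed.

Section density.
Context d (T : measurableType d) (p q : probability T R).
Variable g : T -> R.
Hypothesis mg : measurable_fun setT g.
Hypothesis pE : forall A, measurable A -> p A = \int[q]_(x in A) (g x)%:E.

Lemma density_dominates : p `<< q.
Proof.
apply/null_content_dominatesP => A mA qA; rewrite pE//.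
apply: null_set_integral => //.
apply: measurable_funTS; exact/measurable_EFinP.
Qed.

Lemma ae_eq_density :
  ae_eq q setT (Radon_Nikodym_SigmaFinite.f p q) (EFin \o g).
Proof.
apply: integral_ae_eq => //.
- exact: (Radon_Nikodym_SigmaFinite.f_integrable density_dominates).
- exact/measurable_EFinP.
- move=> E _ mE; rewrite -pE//.
  by rewrite -(Radon_Nikodym_SigmaFinite.f_integral density_dominates).
Qed.

Lemma ge0_integral_density (h : T -> \bar R) :
  (forall x, 0 <= h x) -> measurable_fun setT h ->
  \int[p]_x h x = \int[q]_x (h x * (g x)%:E).
Proof.
move=> h0 mh.
rewrite -(Radon_Nikodym_SigmaFinite.change_of_variables density_dominates)//.
have mg' : measurable_fun setT (EFin \o g) by exact/measurable_EFinP.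
apply: ae_eq_integral => //.
- apply: emeasurable_funM => //; apply: measurable_int.
  exact: (Radon_Nikodym_SigmaFinite.f_integrable density_dominates).
- exact: emeasurable_funM.
- by apply: ae_eqe_mul2l; exact: ae_eq_density.
Qed.

Lemma ae_eq_density_RN : ae_eq q setT (density p q) (EFin \o g).
Proof.
apply: ae_eq_trans ae_eq_density; apply: ae_eq_sym.
exact: (ae_eq_Radon_Nikodym_SigmaFinite density_dominates).
Qed.

End density.

Lemma ae_dominates d (T : measurableType d) (p q : probability T R)
    (P : set T) :
  p `<< q -> {ae q, forall x, P x} -> {ae p, forall x, P x}.
Proof.
move=> /null_content_dominatesP pq [N [mN qN PN]].
by exists N; split => //; exact: pq.
Qed.

Section coupling.
Context d1 d2 (T1 : measurableType d1) (T2 : measurableType d2).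
Variables (m1 : probability T1 R) (m2 : probability T2 R).
Variable p : probability (T1 * T2)%type R.
Hypothesis cp : coupling m1 m2 p.

Lemma coupling_integral1 (f : T1 -> \bar R) :
  (forall x, 0 <= f x) -> measurable_fun setT f ->
  \int[p]_a f a.1 = \int[m1]_x f x.
Proof.
move=> f0 mf.
transitivity (\int[pushforward p fst]_x f x).
  by rewrite ge0_integral_pushforward.
apply: eq_measure_integral => A mA _.
transitivity (p (A `*` setT)); last by case: cp => + _; apply.
rewrite /pushforward; congr (p _).
by apply/seteqP; split => -[x y] //= [].
Qed.

Lemma coupling_integral2 (f : T2 -> \bar R) :
  (forall x, 0 <= f x) -> measurable_fun setT f ->
  \int[p]_a f a.2 = \int[m2]_x f x.
Proof.
move=> f0 mf.
transitivity (\int[pushforward p snd]_x f x).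
  by rewrite ge0_integral_pushforward.
apply: eq_measure_integral => A mA _.
transitivity (p (setT `*` A)); last by case: cp => _; apply.
rewrite /pushforward; congr (p _).
by apply/seteqP; split => -[x y] //= [].
Qed.

Lemma coupling_ae1 (P : set T1) :
  {ae m1, forall x, P x} -> {ae p, forall a, P a.1}.
Proof.
move=> [N [mN m1N PN]]; exists (N `*` setT); split.
- exact: measurableX.
- by rewrite -m1N; case: cp => + _; apply.
- by move=> a Pa; split => //; exact: PN.
Qed.

Lemma coupling_ae2 (P : set T2) :
  {ae m2, forall x, P x} -> {ae p, forall a, P a.2}.
Proof.
move=> [N [mN m2N PN]]; exists (setT `*` N); split.
- exact: measurableX.
- by rewrite -m2N; case: cp => _; apply.
- by move=> a Pa; split => //; exact: PN.
Qed.

End coupling.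

Lemma real_density d (T : measurableType d) (p q : probability T R) :
  p `<< q -> exists r : T -> R, [/\ forall x, (0 <= r x)%R,
    measurable_fun setT r &
    forall A, measurable A -> p A = \int[q]_(x in A) (r x)%:E].
Proof.
move=> pq; pose f := Radon_Nikodym_SigmaFinite.f p q.
have fE x : (fine (f x))%:E = f x.
  by rewrite fineK// Radon_Nikodym_SigmaFinite.f_fin_num.
exists (fine \o f); split.
- by move=> x; rewrite -lee_fin fE; exact: Radon_Nikodym_SigmaFinite.f_ge0.
- apply: measurableT_comp => //.
  exact: measurable_int (Radon_Nikodym_SigmaFinite.f_integrable pq).
- move=> A mA; rewrite (Radon_Nikodym_SigmaFinite.f_integral pq)//.
  by apply: eq_integral => x _; rewrite /= fE.
Qed.

Lemma density_integral d (T : measurableType d) (p q : probability T R)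
    (A : set T) :
  p `<< q -> measurable A -> p A = \int[q]_(x in A) density p q x.
Proof.
move=> pq mA.
exact: (@Radon_Nikodym_integral _ _ _ (charge_of_finite_measure p) q A pq mA).
Qed.

(** By Tonelli, the density of mu with respect to nu is also the density of
    rho \x mu with respect to rho \x nu. *)
Lemma ge0_integral_prod_change d1 d2 (T1 : measurableType d1)
    (T2 : measurableType d2) (rho : probability T1 R) (mu nu : probability T2 R)
    (r : T2 -> R) (h : T1 * T2 -> \bar R) :
  (forall z, (0 <= r z)%R) -> measurable_fun setT r ->
  (forall A, measurable A -> mu A = \int[nu]_(z in A) (r z)%:E) ->
  (forall a, 0 <= h a) -> measurable_fun setT h ->
  \int[rho \x mu]_a h a = \int[rho \x nu]_a (h a * (r a.2)%:E).
Proof.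
move=> r0 mr muE h0 mh.
have mr2 : measurable_fun setT (fun a : T1 * T2 => (r a.2)%:E).
  by apply/measurable_EFinP; exact: measurableT_comp.
rewrite fubini_tonelli1// fubini_tonelli1//; last 2 first.
- exact: emeasurable_funM.
- by move=> a; rewrite mule_ge0// lee_fin.
apply: eq_integral => x _; rewrite /fubini_F.
rewrite (ge0_integral_density mr muE)//.
exact: measurableT_comp.
Qed.

End integration.

Lemma integrable_affine {R : realType} d (T : measurableType d)
    (m : probability T R) n (F : 'I_n -> T -> R) (h : T -> R)
    (cf : 'I_n -> R) (K : R) :
  (forall i, m.-integrable setT (fun x => (F i x)%:E)) ->
  m.-integrable setT (fun x => (h x)%:E) ->
  let A x := \sum_i cf i * F i x + K * h x in
  m.-integrable setT (fun x => (A x)%:E) /\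
  (\int[m]_x (A x)%:E = (\sum_i cf i * \int[m]_x F i x + K * \int[m]_x h x)%R%:E)%E.
Proof.
move=> intF inth A.
have EA : (fun x => (A x)%:E) =
    (fun x => (\sum_(i < n) (cf i)%:E * (F i x)%:E) + K%:E * (h x)%:E)%E.
  by apply/funext => x; rewrite /A EFinD sumEFin.
have intS : m.-integrable setT (fun x => \sum_(i < n) (cf i)%:E * (F i x)%:E)%E.
  by apply: integrable_sum => // i _; exact: integrableZl.
have intK : m.-integrable setT (fun x => K%:E * (h x)%:E)%E.
  exact: integrableZl.
split; first by rewrite EA; exact: integrableD.
rewrite EA integralD// integralZl// integral_sum//; last first.
  by move=> i; exact: integrableZl.
rewrite EFinD -sumEFin EFinM; congr (_ + _ * _)%E; last first.
  by rewrite fineK//; exact: integrable_fin_num.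
apply: eq_bigr => i _; rewrite integralZl// EFinM; congr (_ * _)%E.
by rewrite fineK//; exact: integrable_fin_num.
Qed.

Lemma coupling_product {R : realType} d1 d2 (T1 : measurableType d1)
    (T2 : measurableType d2) (m1 : probability T1 R) (m2 : probability T2 R) :
  coupling m1 m2 (m1 \x m2)%E.
Proof.
split => [A mA|B mB].
  transitivity (m1 A * m2 setT)%E; first exact: product_measure1E.
  rewrite -[RHS]mule1; congr (_ * _)%E; exact: probability_setT.
transitivity (m1 setT * m2 B)%E; first exact: product_measure1E.
rewrite -[RHS]mul1e; congr (_ * _)%E; exact: probability_setT.
Qed.

Lemma ae_nonempty {R : realType} d (T : measurableType d)
    (m : probability T R) (P : set T) :
  {ae m, forall x, P x} -> exists x, P x.
Proof.
move=> aeP; apply: contrapT => nP.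
have : m.-negligible setT.
  by apply: negligibleS aeP => x _ Px; apply: nP; exists x.
move=> /(negligibleP m measurableT) m0.
have := probability_setT m; rewrite m0 => /eqP.
by rewrite eqe eq_sym oner_eq0.
Qed.

(** * Relative entropy *)

Section entropy.
Context {R : realType}.
Local Open Scope ereal_scope.

Lemma measurable_lne : measurable_fun setT (@lne R).
Proof.
rewrite (_ : @lne R = fun x : \bar R => if x <= 0 then -oo
    else if x == +oo then +oo else (ln (fine x))%:E); last first.
  by apply/funext => -[r| |] /=; rewrite ?lee_fin ?leNye ?leye_eq.
apply: measurable_fun_ifT => //; first exact: measurable_fun_lee.
apply: measurable_fun_ifT => //; first exact: measurable_fun_eqe.
by apply/measurable_EFinP; apply: measurableT_comp.
Qed.

Lemma measurable_expeR : measurable_fun setT (@expeR R).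
Proof.
rewrite (_ : @expeR R = fun x : \bar R => if x == -oo then 0
    else if x == +oo then +oo else (expR (fine x))%:E); last first.
  by apply/funext => -[r| |] //=.
apply: measurable_fun_ifT => //; first exact: measurable_fun_eqe.
apply: measurable_fun_ifT => //; first exact: measurable_fun_eqe.
by apply/measurable_EFinP; apply: measurableT_comp.
Qed.

Lemma lne_mule (x y : R) : (0 < x)%R -> (0 <= y)%R ->
  lne (x * y)%:E = (ln x)%:E + lne y%:E.
Proof.
move=> x0; rewrite le_eqVlt => /predU1P[<-|y0].
  by rewrite mulr0 /= lexx.
by rewrite !lne_EFin ?mulr_gt0// lnM.
Qed.

(** The Radon-Nikodym derivative in the definition of the relative entropy may be
    replaced by any explicit density. *)
Lemma rel_entropy_density d (T : measurableType d) (p q : probability T R)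
    (g : T -> R) :
  (forall x, (0 <= g x)%R) -> measurable_fun setT g ->
  (forall A, measurable A -> p A = \int[q]_(x in A) (g x)%:E) ->
  rel_entropy p q = \int[p]_x lne (g x)%:E.
Proof.
move=> g0 mg pE.
have pq := density_dominates mg pE.
rewrite /rel_entropy asboolT//.
apply: ae_eq_integral => //.
- apply: measurableT_comp; first exact: measurable_lne.
  exact: measurable_int (Radon_Nikodym_integrable _).
- apply: measurableT_comp; first exact: measurable_lne.
  exact/measurable_EFinP.
- have : {ae p, forall x, density p q x = (g x)%:E}.
    apply: (ae_dominates pq).
    by have := ae_eq_density_RN mg pE; apply: filterS => x; exact.
  by apply: filterS => x /= -> _.
Qed.

(** The negative part of t ln t is at most 1. Hence the integral defining a
    relative entropy never takes the form oo - oo. *)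
Lemma integral_lne_density_neg d (T : measurableType d) (p q : probability T R)
    (g : T -> R) :
  (forall x, (0 <= g x)%R) -> measurable_fun setT g ->
  (forall A, measurable A -> p A = \int[q]_(x in A) (g x)%:E) ->
  \int[p]_x ((fun x => lne (g x)%:E)^\- x) <= 1.
Proof.
move=> g0 mg pE.
have mlg : measurable_fun setT (fun x => lne (g x)%:E).
  apply: measurableT_comp; first exact: measurable_lne.
  exact/measurable_EFinP.
rewrite (ge0_integral_density mg pE)//; last exact: measurable_funeneg.
have -> : (1 : \bar R) = \int[q]_x (cst 1) x.
  by rewrite integral_cst// mul1e; apply/esym; exact: probability_setT.
apply: ge0_le_integral_nomeas => x.
  by rewrite mule_ge0// lee_fin.
rewrite funenegE; have [->|gxn0] := eqVneq (g x) 0%R.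
  by rewrite mule0 lee01.
have gx0 : (0 < g x)%R by rewrite lt_neqAle eq_sym gxn0 g0.
rewrite lne_EFin//= maxe_pMl ?lee_fin ?(ltW gx0)//.
rewrite mul0e ge_max lee01 andbT -EFinM lee_fin.
have := @expR_ge1Dx R (ln (g x)^-1).
rewrite lnK ?posrE ?invr_gt0// lnV ?posrE// => H.
rewrite -(ler_pM2l gx0) mulrDr divff ?gt_eqF// mulrN in H.
by rewrite mulrC mulrN; lra.
Qed.
Lemma rel_entropy_neqNy d (T : measurableType d) (p q : probability T R) :
  rel_entropy p q != -oo.
Proof.
have [pq|npq] := pselect (p `<< q); last by rewrite /rel_entropy asboolF.
have [r [r0 mr pE]] := real_density pq.
rewrite (rel_entropy_density r0 mr pE) integralE.
have := integral_lne_density_neg r0 mr pE.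
set N := \int[p]_x (_^\- x) => N1.
have Nfin : N \is a fin_num.
  by rewrite ge0_fin_numE ?integral_ge0// (le_lt_trans N1)// ltry.
rewrite gt_eqF// -(fineK Nfin) -EFinN.
apply: (@lt_le_trans _ _ (- fine N)%:E); first exact: ltNyr.
by rewrite leeDr// integral_ge0.
Qed.

End entropy.

Section chain_rule.
Context {R : realType} d1 d2 (X : measurableType d1) (Y : measurableType d2).
Variables (rho : probability X R) (nu mu : probability Y R).
Variables (P Q : probability (X * Y)%type R).
Variables (g : X * Y -> R) (a : X -> R) (b : Y -> R).
Hypotheses (g0 : forall u, 0 <= g u) (mg : measurable_fun setT g).
Hypotheses (ma : measurable_fun setT a) (mb : measurable_fun setT b).
Hypothesis cQ : coupling rho mu Q.
Hypothesis PE : forall A, measurable A ->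
  P A = (\int[rho \x nu]_(u in A) (g u)%:E)%E.
Hypothesis QE : forall A, measurable A ->
  Q A = (\int[rho \x mu]_(u in A) (expR (a u.1 + b u.2) * g u)%:E)%E.

Let s (u : X * Y) := a u.1 + b u.2.

Let ms : measurable_fun setT s.
Proof. by apply: measurable_funD; exact: measurableT_comp. Qed.

(** If g is the density of P and exp(s) g that of Q, with respect to rho \x nu and
    rho \x mu, then exp(s(x,z)) (dmu/dnu)(z) is the density of Q with
    respect to P. Its logarithm splits into s and ln (dmu/dnu), and the second
    marginal of Q is mu. *)
Lemma rel_entropy_chain_rule : Q.-integrable setT (EFin \o s) ->
  (rel_entropy Q P <= rel_entropy mu nu + \int[Q]_u (s u)%:E)%E.
Proof.
move=> intS.
have finS : (\int[Q]_u (s u)%:E)%E \is a fin_num by exact: integrable_fin_num.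
have [munu|nmunu] := pselect (mu `<< nu); last first.
  rewrite [rel_entropy mu nu]/rel_entropy asboolF//.
  by rewrite addye ?leey//; move: finS; rewrite fin_numE => /andP[].
have [r [r0 mr muE]] := real_density munu.
have mes : measurable_fun setT (fun u => expR (s u)) by exact: measurableT_comp.
have mr2 : measurable_fun setT (fun u : X * Y => r u.2) by exact: measurableT_comp.
pose f u := expR (s u) * r u.2.
have f0 u : 0 <= f u by rewrite mulr_ge0// expR_ge0.
have mf : measurable_fun setT f by exact: measurable_funM.
have QPE A : measurable A -> Q A = (\int[P]_(u in A) (f u)%:E)%E.
  move=> mA; rewrite QE// [LHS]integral_mkcond [RHS]integral_mkcond.
  rewrite (ge0_integral_prod_change rho r0 mr muE)//; last 2 first.
  - by apply: erestrict_ge0 => u _; rewrite lee_fin mulr_ge0// expR_ge0.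
  - apply: (measurable_restrictT _ mA).1; apply: measurable_funTS.
    by apply/measurable_EFinP; exact: measurable_funM.
  rewrite (ge0_integral_density mg PE); last 2 first.
  - by apply: erestrict_ge0 => u _; rewrite lee_fin.
  - apply: (measurable_restrictT _ mA).1; apply: measurable_funTS.
    exact/measurable_EFinP.
  apply: eq_integral => u _; rewrite /patch; case: ifP => _.
    by rewrite -!EFinM /f mulrAC.
  by rewrite !mul0e.
rewrite (rel_entropy_density f0 mf QPE) (rel_entropy_density r0 mr muE).
pose l z := lne (r z)%:E.
have ml : measurable_fun setT l.
  apply: measurableT_comp; first exact: measurable_lne.
  exact/measurable_EFinP.
under [leLHS]eq_integral => u _ do rewrite lne_mule ?expR_gt0// expRK.
have := integral_lne_density_neg r0 mr muE.
rewrite -/l => l1.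
have lneg : (\int[mu]_z (l^\- z))%E \is a fin_num.
  by rewrite ge0_fin_numE ?integral_ge0// (le_lt_trans l1)// ltry.
have [lpos|lpos] := eqVneq (\int[mu]_z (l^\+ z))%E +oo%E.
  rewrite [X in (_ <= X + _)%E]integralE lpos -(fineK lneg) -(fineK finS).
  by rewrite !addye ?leey.
have intl : mu.-integrable setT l.
  apply/integrableP; split => //.
  under eq_integral => z _ do rewrite -[`|l z|%E]/((abse \o l) z) fune_abse.
  rewrite ge0_integralD//; [|exact: measurable_funepos|exact: measurable_funeneg].
  by rewrite lte_add_pinfty ?ltey// -(fineK lneg).
have ml2 : measurable_fun setT (fun u : X * Y => l u.2) by exact: measurableT_comp.
have intl2 : Q.-integrable setT (fun u : X * Y => l u.2).
  apply/integrableP; split => //.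
  rewrite (coupling_integral2 cQ (f := fun z => `|l z|%E))//; last first.
    exact: measurableT_comp.
  by case/integrableP : intl.
rewrite integralD//= addeC leeD2r//.
rewrite integralE [leRHS]integralE.
rewrite -(coupling_integral2 cQ (f := l^\+%E))//; last exact: measurable_funepos.
rewrite -(coupling_integral2 cQ (f := l^\-%E))//; last exact: measurable_funeneg.
rewrite le_eqVlt; apply/orP; left; apply/eqP.
by congr (_ - _)%E; apply: eq_integral => u _; rewrite ?funeposE ?funenegE.
Qed.

End chain_rule.

(** * Duality with bounded test functions *)

Section dual_bound.
Context {R : realType} d1 d2 (X : measurableType d1) (Y : measurableType d2).
Variables (rho : probability X R) (nu mu : probability Y R).
Variable P : probability (X * Y)%type R.
Variables (g : X * Y -> R) (w : Y -> Y -> R) (k : R).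
Hypotheses (g0 : forall u, 0 <= g u) (mg : measurable_fun setT g).
Hypothesis cP : coupling rho nu P.
Hypothesis PE : forall A, measurable A ->
  P A = (\int[rho \x nu]_(u in A) (g u)%:E)%E.
Hypothesis g1 : forall y, (\int[rho]_x (g (x, y))%:E = 1)%E.

(** The logarithmic moment generating function of al under the conditional law
    g(x,z) rho(dx). *)
Definition log_mgf (al : X -> R) (z : Y) : R :=
  ln (fine (\int[rho]_x (expR (al x) * g (x, z))%:E)).

Section test_function.
Variables (al : X -> R) (B : R).
Hypotheses (mal : measurable_fun setT al) (alB : forall x, 0 <= al x <= B).

Let mexp : measurable_fun setT (fun u : X * Y => (expR (al u.1) * g u)%:E).
Proof.
apply/measurable_EFinP; apply: measurable_funM => //.
by do 2 apply: measurableT_comp => //.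
Qed.

Lemma mgf_bounds z :
  (1 <= \int[rho]_x (expR (al x) * g (x, z))%:E <= (expR B)%:E)%E.
Proof.
have mz : measurable_fun setT (fun x => (g (x, z))%:E).
  by apply/measurable_EFinP; apply: measurableT_comp.
apply/andP; split.
  rewrite -(g1 z); apply: ge0_le_integral_nomeas => x; first by rewrite lee_fin.
  rewrite lee_fin ler_peMl// -expR0 ler_expR.
  by have /andP[] := alB x.
rewrite -[leRHS]mule1 -(g1 z) -ge0_integralZl ?lee_fin ?expR_ge0//; last first.
  by move=> x _; rewrite lee_fin.
apply: ge0_le_integral_nomeas => x; first by rewrite lee_fin mulr_ge0 ?expR_ge0.
rewrite -EFinM lee_fin ler_wpM2r// ler_expR.
by have /andP[] := alB x.
Qed.

Lemma mgf_fin_num z :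
  (\int[rho]_x (expR (al x) * g (x, z))%:E)%E \is a fin_num.
Proof.
have /andP[h1 h2] := mgf_bounds z.
by rewrite fin_numElt (lt_le_trans _ h1) ?ltNyr// (le_lt_trans h2) ?ltry.
Qed.

Lemma log_mgf_bounds z : 0 <= log_mgf al z <= B.
Proof.
have /andP[] := mgf_bounds z; rewrite -(fineK (mgf_fin_num z)) !lee_fin => h1 h2.
rewrite /log_mgf ln_ge0//= -[leRHS]expRK ler_ln ?posrE ?expR_gt0//.
exact: lt_le_trans h1.
Qed.

Lemma measurable_log_mgf : measurable_fun setT (log_mgf al).
Proof.
do 2 apply: measurableT_comp => //.
apply: (measurable_fun_fubini_tonelli_G (fun u => (expR (al u.1) * g u)%:E)) => //.
by move=> u; rewrite lee_fin mulr_ge0 ?expR_ge0.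
Qed.

(** The pointwise hypothesis, integrated against tau: the integral over y ~ nu of
    the conditional means of al is its integral against rho, since P has marginals
    rho and nu and density g. *)
Lemma test_function_bound (tau : probability (Y * Y)%type R) :
  coupling mu nu tau -> 0 < k -> (forall z y, 0 <= w z y) ->
  {ae nu, forall y, forall z, (\int[rho]_x (al x * g (x, y))%:E <=
     (log_mgf al z)%:E + (k * w z y)%:E)%E} ->
  (\int[rho]_x (al x)%:E <=
   \int[mu]_z (log_mgf al z)%:E + k%:E * \int[tau]_u (w u.1 u.2)%:E)%E.
Proof.
move=> ct k0 w0 [N [mN nuN Nw]].
have Nw' y : ~ N y -> forall z,
    (\int[rho]_x (al x * g (x, y))%:E <=
     (log_mgf al z)%:E + (k * w z y)%:E)%E.
  by move=> yN; apply: contrapT => /Nw.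
have al0 x : 0 <= al x by have /andP[] := alB x.
have mag : measurable_fun setT (fun u : X * Y => (al u.1 * g u)%:E).
  apply/measurable_EFinP; apply: measurable_funM => //.
  by apply: measurableT_comp.
pose A y := (\int[rho]_x (al x * g (x, y))%:E)%E.
have A0 y : (0 <= A y)%E by apply: integral_ge0 => x _; rewrite lee_fin mulr_ge0.
have mA : measurable_fun setT A.
  apply: (measurable_fun_fubini_tonelli_G (fun u => (al u.1 * g u)%:E)) => //.
  by move=> u; rewrite lee_fin mulr_ge0.
have gam0 z : 0 <= log_mgf al z by have /andP[] := log_mgf_bounds z.
have mgam : measurable_fun setT (fun z => (log_mgf al z)%:E).
  by apply/measurable_EFinP; exact: measurable_log_mgf.
have -> : (\int[rho]_x (al x)%:E = \int[tau]_u A u.2)%E.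
  rewrite -(coupling_integral1 cP (f := fun x => (al x)%:E)); last 2 first.
  - by move=> x; rewrite lee_fin.
  - exact/measurable_EFinP.
  rewrite (ge0_integral_density mg PE); last 2 first.
  - by move=> u; rewrite lee_fin.
  - by apply/measurable_EFinP; exact: measurableT_comp.
  rewrite fubini_tonelli2//; last by move=> u; rewrite mule_ge0// lee_fin.
  by rewrite (coupling_integral2 ct (f := A)).
pose D (u : Y * Y) := (A u.2 - (log_mgf al u.1)%:E)%E.
have mD : measurable_fun setT D.
  apply: emeasurable_funB; first exact: measurableT_comp.
  exact: measurableT_comp mgam measurable_fst.
(* As w is an arbitrary function, the sum of log_mgf and k w cannot be integrated
   term by term. The measurable function C, which vanishes on the exceptional
   set, is inserted below k w. *)
pose C := (D^\+ \_ (setT `*` ~` N))%E.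
have C0 u : (0 <= C u)%E by apply: erestrict_ge0.
have mC : measurable_fun setT C.
  apply: (measurable_restrictT _ _).1.
    by apply: measurableX => //; exact: measurableC.
  by apply: measurable_funTS; exact: measurable_funepos.
have Cw u : (C u <= k%:E * (w u.1 u.2)%:E)%E.
  rewrite /C /patch; case: ifPn => [|_]; last by rewrite mule_ge0 ?lee_fin ?(ltW k0).
  rewrite inE => -[_ /= uN].
  rewrite funeposE ge_max -{2}EFinM lee_fin mulr_ge0 ?(ltW k0)// andbT.
  by rewrite /D leeBlDl//; exact: Nw'.
have intC : (\int[tau]_u C u <= k%:E * \int[tau]_u (w u.1 u.2)%:E)%E.
  rewrite -lee_pdivrMl// -ge0_integralZl// ?lee_fin ?invr_ge0 ?(ltW k0)//.
  apply: ge0_le_integral_nomeas => u.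
    by rewrite mule_ge0 ?lee_fin ?invr_ge0 ?(ltW k0).
  by rewrite lee_pdivrMl.
apply: (le_trans _ (leeD2l _ intC)).
rewrite -(coupling_integral1 ct (f := fun z => (log_mgf al z)%:E))//.
have mgam1 : measurable_fun setT (fun u : Y * Y => (log_mgf al u.1)%:E).
  exact: measurableT_comp mgam measurable_fst.
rewrite -ge0_integralD//; last by move=> u _; rewrite lee_fin.
apply: ae_ge0_le_integral => //.
- exact: measurableT_comp.
- by move=> u _; rewrite adde_ge0 ?lee_fin.
- exact: emeasurable_funD.
have : {ae nu, forall y, ~ N y} by exists N; split => // y /= /contrapT.
move=> /(coupling_ae2 ct); apply: filterS => u /= uN _.
rewrite /C patchE ifT ?inE//= funeposE -leeBlDl//.
by rewrite le_max lexx.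
Qed.

End test_function.
End dual_bound.

Section jensen.
Context {R : realType} d1 d2 (X : measurableType d1) (Y : measurableType d2).
Variables (rho : probability X R) (g : X * Y -> R).
Hypotheses (g0 : forall u, 0 <= g u) (mg : measurable_fun setT g).
Hypothesis g1 : forall y, (\int[rho]_x (g (x, y))%:E = 1)%E.

(** Jensen's inequality for exp(al - La) under g(x,y) rho(dx), together with the
    comparison of the conditional laws at y and z given by La. *)
Lemma jensen_log_mgf (al : X -> R) (B : R) (y z : Y) (La : X -> R) (kappa : R) :
  measurable_fun setT al -> (forall x, 0 <= al x <= B) ->
  rho.-integrable setT (fun x => (La x * g (x, y))%:E) ->
  (\int[rho]_x (La x * g (x, y))%:E = kappa%:E)%E ->
  {ae rho, forall x, expR (- La x) * g (x, y) <= g (x, z)} ->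
  (\int[rho]_x (al x * g (x, y))%:E <= (log_mgf rho g al z + kappa)%:E)%E.
Proof.
move=> mal alB intLa ELa Hae.
have gy : measurable_fun setT (fun x => g (x, y)) by exact: measurableT_comp.
have gz : measurable_fun setT (fun x => g (x, z)) by exact: measurableT_comp.
have intg : rho.-integrable setT (fun x => (g (x, y))%:E).
  apply/integrableP; split; first exact/measurable_EFinP.
  under eq_integral => x _ do rewrite gee0_abs ?lee_fin//.
  by rewrite g1 ltry.
have intag : rho.-integrable setT (fun x => (al x * g (x, y))%:E).
  apply: (@le_integrable _ _ _ _ _ _ _ (fun x => (B%:E * (g (x, y))%:E)%E)) => //.
  - by apply/measurable_EFinP; exact: measurable_funM.
  - move=> x _; have /andP[a0 aB] := alB x.
    have B0 : 0 <= B by exact: le_trans aB.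
    by rewrite -EFinM !gee0_abs ?lee_fin ?mulr_ge0// ler_wpM2r.
  - exact: integrableZl.
have Afin := integrable_fin_num measurableT intag.
rewrite -(fineK Afin); set A := fine _.
have EA : (\int[rho]_x (al x * g (x, y))%:E = A%:E)%E by rewrite fineK.
pose m := A - kappa.
(* F is g(x,y) times the tangent line at m of the exponential, taken at
   al - La; the mean of al - La under g(x,y) rho(dx) is m. *)
pose F x : \bar R := ((expR m)%:E * ((1 - m)%:E * (g (x, y))%:E +
  ((al x * g (x, y))%:E - (La x * g (x, y))%:E)))%E.
have int1 := integrableZl measurableT (1 - m) intg.
have int2 := integrableB measurableT intag intLa.
have int3 := integrableD measurableT int1 int2.
have intF : rho.-integrable setT F by exact: integrableZl.
have EF : (\int[rho]_x F x = (expR m)%:E)%E.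
  rewrite integralZl// integralD// integralZl// integralB// g1 EA ELa.
  rewrite mule1 -EFinB -EFinD -EFinM /m; congr EFin.
  have -> : 1 - (A - kappa) + (A - kappa) = 1 by lra.
  by rewrite mulr1.
have Ifin := mgf_fin_num g0 mg g1 alB z.
have mI : measurable_fun setT (fun x => (expR (al x) * g (x, z))%:E).
  by apply/measurable_EFinP; apply: measurable_funM => //; exact: measurableT_comp.
have : ((expR m)%:E <= \int[rho]_x (expR (al x) * g (x, z))%:E)%E.
  rewrite -EF integralE; apply: (@le_trans _ _ (\int[rho]_x F^\+ x)%E).
    by rewrite leeBlDr ?leeDl ?integral_ge0// integrable_neg_fin_num.
  apply: ae_ge0_le_integral => //.
  - by apply: measurable_funepos; case/integrableP : intF.
  - by move=> x _; rewrite lee_fin mulr_ge0 ?expR_ge0.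
  - apply: filterS Hae => x H _.
    rewrite funeposE ge_max; apply/andP; split; last first.
      by rewrite lee_fin mulr_ge0 ?expR_ge0.
    have -> : F x = (expR m * ((1 - m) * g (x, y) +
        (al x * g (x, y) - La x * g (x, y))))%:E by [].
    rewrite lee_fin.
    apply: (@le_trans _ _ (expR (al x) * (expR (- La x) * g (x, y)))); last first.
      by rewrite ler_wpM2l ?expR_ge0.
    rewrite mulrA -expRD -mulrBl -mulrDl mulrA ler_wpM2r//.
    have -> : expR (al x - La x) = expR m * expR (al x - La x - m).
      by rewrite -expRD; congr expR; lra.
    rewrite ler_wpM2l ?expR_ge0//.
    by have := expR_ge1Dx (al x - La x - m); lra.
rewrite -(fineK Ifin) lee_fin => mI'.
rewrite lee_fin -lerBlDr -/m -[leLHS]expRK ler_ln ?posrE ?expR_gt0//.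
exact: lt_le_trans (expR_gt0 _) mI'.
Qed.

End jensen.

Section truncation.
Context {R : realType}.

(** The truncation of t to [-n, n], shifted by n so that it is non-negative. The
    shift does not affect the difference of al and its log-moment generating
    function. *)
Definition trunc (n : nat) (t : R) : R :=
  Num.max 0 (Num.min (t + n%:R) (n%:R *+ 2)).

Lemma trunc_bounds n t : 0 <= trunc n t <= n%:R *+ 2.
Proof.
rewrite /trunc le_max lexx/= ge_max mulrn_wge0//=.
by rewrite ge_min lexx orbT.
Qed.

Lemma truncE n t : `|t| <= n%:R -> trunc n t = t + n%:R.
Proof.
rewrite ler_norml => /andP[h1 h2]; rewrite /trunc.
by rewrite min_l ?max_r// ?mulr2n ?lerD2r//; lra.
Qed.

Lemma measurable_trunc n : measurable_fun setT (trunc n).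
Proof.
apply: measurable_maxr => //; apply: measurable_minr => //.
by apply: measurable_funD.
Qed.

Lemma le_limn_einf (u v : (\bar R)^nat) (l : \bar R) :
  (forall n, (v n <= u n)%E) -> v @ \oo --> l -> (l <= limn_einf u)%E.
Proof.
move=> vu vl; have [<- _] := cvg_limn_einf_sup vl.
rewrite !limn_einf_lim; apply: lee_lim; [exact: is_cvg_einfs..|].
apply: nearW => n; rewrite /einfs /sdrop.
apply: le_ereal_inf_tmp => _ [m /= nm <-].
by apply: ereal_inf_le; exists (v m) => //; exists m.
Qed.

End truncation.

Section entropy_transport.
Context {R : realType} d1 d2 (X : measurableType d1) (Y : measurableType d2).
Variables (rho : probability X R) (nu mu : probability Y R).
Variables (P Q : probability (X * Y)%type R).
Variables (g : X * Y -> R) (a : X -> R) (b : Y -> R).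
Variables (w : Y -> Y -> R) (k : R).
Hypotheses (g0 : forall u, 0 <= g u) (mg : measurable_fun setT g).
Hypotheses (ma : measurable_fun setT a) (mb : measurable_fun setT b).
Hypotheses (cP : coupling rho nu P) (cQ : coupling rho mu Q).
Hypothesis PE : forall A, measurable A ->
  P A = (\int[rho \x nu]_(u in A) (g u)%:E)%E.
Hypothesis QE : forall A, measurable A ->
  Q A = (\int[rho \x mu]_(u in A) (expR (a u.1 + b u.2) * g u)%:E)%E.
Hypothesis g1 : forall y, (\int[rho]_x (g (x, y))%:E = 1)%E.
Hypothesis g2 : {ae mu, forall z,
  (\int[rho]_x (expR (a x + b z) * g (x, z))%:E = 1)%E}.
Hypotheses (k0 : 0 < k) (w0 : forall z y, 0 <= w z y).
Hypothesis dual : {ae nu, forall y, forall (al : X -> R) (B : R),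
  measurable_fun setT al -> (forall x, 0 <= al x <= B) ->
  forall z, (\int[rho]_x (al x * g (x, y))%:E <=
     (log_mgf rho g al z)%:E + (k * w z y)%:E)%E}.

Let s (u : X * Y) := a u.1 + b u.2.

Let ms : measurable_fun setT s.
Proof. by apply: measurable_funD; exact: measurableT_comp. Qed.

Let al n x := trunc n (a x).

Let mal n : measurable_fun setT (al n).
Proof. exact: measurableT_comp (measurable_trunc n) ma. Qed.

Let alB n x : 0 <= al n x <= n%:R *+ 2.
Proof. exact: trunc_bounds. Qed.

Let gam n := log_mgf rho g (al n).

Let gam0 n z : 0 <= gam n z.
Proof. by have /andP[] := log_mgf_bounds g0 mg g1 (alB n) z. Qed.

(** Pointwise, exp(al n) <= exp(n) exp(a) + 1, and the conditional mean of exp(a) at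
    z is exp(-b(z)). *)
Lemma mgf_trunc_le n z (I : R) :
  (\int[rho]_x (expR (a x + b z) * g (x, z))%:E = 1)%E ->
  (\int[rho]_x (expR (al n x) * g (x, z))%:E = I%:E)%E ->
  I <= expR (n%:R - b z) + 1.
Proof.
move=> gz EI; rewrite -lee_fin -EI.
have mz : measurable_fun setT (fun x => g (x, z)).
  by apply: measurableT_comp.
have me : measurable_fun setT (fun x => expR (a x + b z) * g (x, z)).
  apply: measurable_funM => //; apply: measurableT_comp => //.
  exact: measurable_funD.
apply: (@le_trans _ _ (\int[rho]_x ((expR (n%:R - b z))%:E *
    (expR (a x + b z) * g (x, z))%:E + (g (x, z))%:E))%E).
  apply: ge0_le_integral_nomeas => x.
    by rewrite lee_fin mulr_ge0 ?expR_ge0.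
  rewrite -EFinM -EFinD lee_fin mulrA -expRD.
  have -> : n%:R - b z + (a x + b z) = a x + n%:R by lra.
  rewrite -[X in _ <= _ + X]mul1r -mulrDl ler_wpM2r// /al /trunc.
  rewrite /Num.max; case: ifPn => _; last by rewrite expR0 lerDr expR_ge0.
  apply: ler_wpDr => //; rewrite ler_expR.
  by rewrite ge_min lexx.
rewrite ge0_integralD//; last 4 first.
- by move=> x _; rewrite mule_ge0 ?lee_fin ?mulr_ge0 ?expR_ge0.
- apply: measurable_funeM; exact/measurable_EFinP.
- by move=> x _; rewrite lee_fin.
- exact/measurable_EFinP.
rewrite ge0_integralZl ?lee_fin ?expR_ge0//; last 2 first.
- exact/measurable_EFinP.
- by move=> x _; rewrite lee_fin mulr_ge0 ?expR_ge0.
by rewrite gz g1 mule1.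
Qed.


Let gam_expP n z : exists2 I : R, 0 < I &
  (\int[rho]_x (expR (al n x) * g (x, z))%:E = I%:E)%E /\ gam n z = ln I.
Proof.
have fin := mgf_fin_num g0 mg g1 (alB n) z.
have /andP[] := mgf_bounds g0 mg g1 (alB n) z.
rewrite -(fineK fin) lee_fin => h1 _.
exists (fine (\int[rho]_x (expR (al n x) * g (x, z))%:E)%E) => //.
exact: lt_le_trans h1.
Qed.

(** A lower bound for al n - gam n that does not depend on n. Where a <= n it
    comes from [mgf_trunc_le]; where a > n, al n takes its maximal value 2n,
    which also bounds gam n. *)
Lemma trunc_lower n x z :
  (\int[rho]_x (expR (a x + b z) * g (x, z))%:E = 1)%E ->
  gam n z - al n x <= expR (- s (x, z)).
Proof.
move=> gz; have [I I0 [EI ->]] := gam_expP n z.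
have e0 := expR_ge0 (- s (x, z)).
have [an|an] := leP (a x) n%:R; last first.
  have alE : al n x = n%:R *+ 2.
    have n0 : 0 <= n%:R :> R by [].
    by rewrite /al /trunc min_r ?max_r ?mulrn_wge0// mulr2n lerD2r ltW.
  have : gam n z <= n%:R *+ 2.
    by have /andP[] := log_mgf_bounds g0 mg g1 (alB n) z.
  have [I' I'0 [EI' ->]] := gam_expP n z.
  have -> : I = I' by move: EI'; rewrite EI => -[].
  by rewrite alE => H; lra.
have := mgf_trunc_le gz EI => IE.
rewrite lerBlDl -[leRHS]expRK ler_ln ?posrE ?expR_gt0//.
apply: (le_trans IE).
have H1 : expR (al n x) * (1 + expR (- s (x, z))) <= expR (al n x + expR (- s (x, z))).
  by rewrite expRD ler_wpM2l ?expR_ge0// expR_ge1Dx.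
apply: le_trans H1; rewrite mulrDr mulr1 [leRHS]addrC.
apply: lerD; last first.
  by rewrite -[leLHS]expR0 ler_expR; have /andP[] := alB n x.
rewrite -expRD ler_expR /s /=.
have : a x + n%:R <= al n x.
  rewrite /al /trunc le_max; apply/orP; right.
  by rewrite le_min lexx mulr2n lerD2r.
by lra.
Qed.

(** The left-hand side tends to s(x,z), which gives the lower limit required by
    Fatou's lemma. *)
Lemma trunc_limit n x z :
  (\int[rho]_x (expR (a x + b z) * g (x, z))%:E = 1)%E ->
  `|a x| <= n%:R ->
  s (x, z) - expR (b z - n%:R) <= al n x - gam n z.
Proof.
move=> gz an; have [I I0 [EI ->]] := gam_expP n z.
have := mgf_trunc_le gz EI => IE.
suff : ln I <= n%:R - b z + expR (b z - n%:R).
  by rewrite /al truncE// /s /=; lra.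
rewrite -[leRHS]expRK ler_ln ?posrE ?expR_gt0//.
apply: (le_trans IE); rewrite [leRHS]expRD.
have := expR_ge1Dx (expR (b z - n%:R)).
move=> /(ler_wpM2l (expR_ge0 (n%:R - b z))); apply: le_trans.
rewrite mulrDr mulr1 -expRD.
have -> : n%:R - b z + (b z - n%:R) = 0 by lra.
by rewrite expR0 addrC.
Qed.

Let mexpN : measurable_fun setT (fun u => (expR (- s u))%:E).
Proof.
apply/measurable_EFinP; apply: measurableT_comp => //.
exact: measurableT_comp.
Qed.

(** exp(-s) turns Q into the measure of density g with respect to rho \x mu,
    which is again a probability. *)
Lemma integral_expN : (\int[Q]_u (expR (- s u))%:E = 1)%E.
Proof.
have mes : measurable_fun setT (fun u => expR (s u) * g u).
  by apply: measurable_funM => //; exact: measurableT_comp.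
rewrite (ge0_integral_density mes QE)//.
transitivity (\int[rho \x mu]_u (g u)%:E)%E.
  by apply: eq_integral => u _; rewrite -EFinM mulrA -expRD addNr expR0 mul1r.
have mgE : measurable_fun setT (fun u => (g u)%:E) by exact/measurable_EFinP.
rewrite fubini_tonelli2//.
rewrite (eq_integral (cst 1%E)); last by move=> z _; rewrite /fubini_G g1.
by rewrite integral_cst// mul1e; exact: probability_setT.
Qed.

(** The functions to which Fatou's lemma is applied. The maximum with 0 changes
    them only on a null set, by [trunc_lower]. *)
Let f n (u : X * Y) : \bar R :=
  (Num.max 0 (al n u.1 - gam n u.2 + expR (- s u)))%:E.

Let mgam n : measurable_fun setT (gam n).
Proof. exact: measurable_log_mgf. Qed.

Let mf n : measurable_fun setT (f n).
Proof.
apply/measurable_EFinP; apply: measurable_maxr => //.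
apply: measurable_funD; last exact/measurable_EFinP.
apply: measurable_funB; [exact: measurableT_comp|].
exact: measurableT_comp (mgam n) measurable_snd.
Qed.

Let Qgood : {ae Q, forall u : X * Y,
  (\int[rho]_x (expR (a x + b u.2) * g (x, u.2))%:E = 1)%E}.
Proof. exact: (coupling_ae2 cQ g2). Qed.

(** The integral of gam n is moved to the other side of the equation, so that every
    integrand is non-negative; being finite, it cancels at the end. *)
Lemma integral_trunc_bound (tau : probability (Y * Y)%type R) n :
  coupling mu nu tau ->
  (\int[Q]_u f n u <= k%:E * \int[tau]_u (w u.1 u.2)%:E + 1)%E.
Proof.
move=> ct.
have mg2 : measurable_fun setT (fun u : X * Y => (gam n u.2)%:E).
  by apply/measurable_EFinP; exact: measurableT_comp (mgam n) measurable_snd.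
have ma1 : measurable_fun setT (fun u : X * Y => (al n u.1)%:E).
  by apply/measurable_EFinP; exact: measurableT_comp.
have f0 m u : (0 <= f m u)%E by rewrite lee_fin le_max lexx.
have al0 x : 0 <= al n x by have /andP[] := alB n x.
have E : (\int[Q]_u (f n u + (gam n u.2)%:E) =
    \int[Q]_u ((al n u.1)%:E + (expR (- s u))%:E))%E.
  apply: ae_eq_integral => //; [exact: emeasurable_funD..|].
  apply: filterS Qgood => -[x z] /= gz _.
  rewrite /f max_r /=; first by rewrite -!EFinD; congr EFin; lra.
  by have := trunc_lower n x gz; lra.
have gfin : (\int[mu]_z (gam n z)%:E)%E \is a fin_num.
  rewrite ge0_fin_numE; last by apply: integral_ge0 => z _; rewrite lee_fin.
  apply: (@le_lt_trans _ _ (\int[mu]_z (cst (n%:R *+ 2)%:E) z)%E).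
    apply: ge0_le_integral_nomeas => z; first by rewrite lee_fin.
    by rewrite lee_fin; have /andP[] := log_mgf_bounds g0 mg g1 (alB n) z.
  apply: integrable_lty => //; exact: finite_measure_integrable_cst.
have gam2_ge0 (u : X * Y) : [set: X * Y] u -> (0 <= (gam n u.2)%:E)%E.
  by move=> _; rewrite lee_fin.
have al1_ge0 (u : X * Y) : [set: X * Y] u -> (0 <= (al n u.1)%:E)%E.
  by move=> _; rewrite lee_fin.
have gamE0 z : (0 <= (gam n z)%:E)%E by rewrite lee_fin.
have alE0 x : (0 <= (al n x)%:E)%E by rewrite lee_fin.
have mgamE : measurable_fun setT (fun z => (gam n z)%:E) by exact/measurable_EFinP.
have malE : measurable_fun setT (fun x => (al n x)%:E) by exact/measurable_EFinP.
have exp_ge0 (u : X * Y) : [set: X * Y] u -> (0 <= (expR (- s u))%:E)%E.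
  by move=> _; rewrite lee_fin expR_ge0.
move: E; rewrite ge0_integralD// ge0_integralD//.
rewrite integral_expN (coupling_integral2 cQ (f := fun z => (gam n z)%:E))//.
rewrite (coupling_integral1 cQ (f := fun x => (al n x)%:E))//.
move=> E.
have := test_function_bound g0 mg cP PE g1 (mal n) (alB n) ct k0 w0.
have dual_n : {ae nu, forall y, forall z,
    (\int[rho]_x (al n x * g (x, y))%:E <=
     (log_mgf rho g (al n) z)%:E + (k * w z y)%:E)%E}.
  by apply: filterS dual => y; apply.
move=> /(_ dual_n) H.
rewrite -(leeD2rE _ _ gfin) E; apply: (le_trans (leeD2r _ H)).
by rewrite [leRHS]addeAC [X in (X + _ <= _)%E]addeC.
Qed.

(** Fatou's lemma along the truncations. It is applied to s + exp(-s), which is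
    non-negative because exp(t) >= 1 + t. *)
Lemma integral_log_density_le (tau : probability (Y * Y)%type R) :
  coupling mu nu tau -> (\int[tau]_u (w u.1 u.2)%:E < +oo)%E ->
  Q.-integrable setT (EFin \o s) /\
  (\int[Q]_u (s u)%:E <= k%:E * \int[tau]_u (w u.1 u.2)%:E)%E.
Proof.
move=> ct wfin.
set W := (\int[tau]_u (w u.1 u.2)%:E)%E.
have W0 : (0 <= W)%E by apply: integral_ge0 => u _; rewrite lee_fin.
have Wfin : W \is a fin_num by rewrite ge0_fin_numE.
pose h u := (s u + expR (- s u))%:E.
have f0 m u : (0 <= f m u)%E by rewrite lee_fin le_max lexx.
have h0 u : (0 <= h u)%E.
  by rewrite lee_fin; have := expR_ge1Dx (- s u); lra.
have mh : measurable_fun setT h.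
  apply/measurable_EFinP; apply: measurable_funD => //; exact/measurable_EFinP.
have hW : (\int[Q]_u h u <= k%:E * W + 1)%E.
  apply: (@le_trans _ _ (\int[Q]_u limn_einf (f^~ u))%E).
    apply: ae_ge0_le_integral => //.
    - move=> u _; apply: (@le_limn_einf _ _ (cst 0%E)) => //.
      exact: cvg_cst.
    - rewrite (_ : (fun _ => _) = (fun u => limn (einfs (f^~ u)))); last first.
        by apply/funext => u; rewrite limn_einf_lim.
      apply: (emeasurable_fun_cvg (fun n u => einfs (f^~ u) n)).
      + by move=> n; exact: measurable_fun_einfs.
      + by move=> u _; exact: is_cvg_einfs.
    apply: filterS Qgood => -[x z] /= gz _.
    pose v n : R := if `|a x| <= n%:R
      then s (x, z) - expR (b z - n%:R) + expR (- s (x, z)) else 0.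
    apply: (@le_limn_einf _ _ (EFin \o v)) => [n|].
      rewrite lee_fin le_max /v; case: ifPn => an; last by rewrite lexx.
      by apply/orP; right; rewrite lerD2r; exact: trunc_limit.
    apply: cvg_EFin; first by near=> n.
    have : (fun n => s (x, z) - expR (b z - n%:R) + expR (- s (x, z))) @ \oo -->
        s (x, z) - 0 + expR (- s (x, z)).
      apply: cvgD; last exact: cvg_cst.
      apply: cvgB; first exact: cvg_cst.
      rewrite (_ : (fun n : nat => _) =
          (fun n : nat => expR (b z) * expR (- n%:R))); last first.
        by apply/funext => n; rewrite expRD.
      rewrite -[X in _ --> X](mulr0 (expR (b z))); apply: cvgMl_tmp.
      exact: (cvg_comp _ _ cvgr_idn (@cvgr_expR R)).
    rewrite subr0; apply: cvg_trans; apply: near_eq_cvg.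
    near=> n; have an : `|a x| <= n%:R by near: n; exact: nbhs_infty_ger.
    by rewrite /= /v an.
  apply: (le_trans (fatou _ _ _ _)) => //.
  rewrite limn_einf_lim; apply: lime_le; first exact: is_cvg_einfs.
  apply: nearW => n; apply: le_trans (integral_trunc_bound n ct).
  by apply: ereal_inf_lbound; exists n => /=.
have hfin : (\int[Q]_u h u < +oo)%E.
  by apply: le_lt_trans hW _; rewrite -(fineK Wfin) -EFinM -EFinD ltry.
have inth : Q.-integrable setT h.
  apply/integrableP; split => //.
  by under eq_integral => u _ do rewrite gee0_abs//.
have inte : Q.-integrable setT (fun u => (expR (- s u))%:E).
  apply/integrableP; split => //.
  under eq_integral => u _ do rewrite gee0_abs ?lee_fin ?expR_ge0//.
  by rewrite integral_expN ltry.
have sE : EFin \o s = (h \- (fun u => (expR (- s u))%:E))%E.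
  by apply/funext => u /=; rewrite /h -EFinB addrK.
have ints : Q.-integrable setT (EFin \o s) by rewrite sE; exact: integrableB.
split => //; rewrite -[X in (X <= _)%E]/(\int[Q]_u (EFin \o s) u)%E sE.
rewrite integralB//= integral_expN leeBlDr//.
Unshelve. all: by end_near. Qed.

End entropy_transport.

(** * Continuously differentiable functions and gradients *)

Section C1_differentiable.
Context {R : realType} {n : nat}.
Implicit Types (f : 'rV[R]_n -> R) (u h x : 'rV[R]_n).

(** Parametrising the segment by r |-> t r with r in [0, 1] treats both signs of t
    at once. *)
Lemma MVT_line f x (e : 'rV[R]_n) (t : R) :
  (forall s : R, `|s| <= `|t| -> derivable f (x + s *: e) e) ->
  exists2 s : R, `|s| <= `|t| &
    f (x + t *: e) - f x = t * 'D_e f (x + s *: e).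
Proof.
move=> fd.
pose phi (r : R) := f (x + (t * r) *: e).
have dline (s : R) : `|s| <= `|t| ->
    is_derive s 1 (fun r : R => f (x + r *: e)) ('D_e f (x + s *: e)).
  move=> st; have := fd s st => fds.
  suff E : (fun h : R => h^-1 *:
               (((fun r : R => f (x + r *: e)) \o shift s) (h *: (1 : R)) -
                 f (x + s *: e))) =
           (fun h : R => h^-1 *: ((f \o shift (x + s *: e)) (h *: e) - f (x + s *: e))).
    by apply: DeriveDef; rewrite /derivable /derive E.
  apply/funext => k /=; congr (_ *: (f _ - _)).
  by rewrite [k *: (1 : R)]mulr1 scalerDl addrCA addrA.
have dmul (r : R) : is_derive r 1 ( *%R t) t.
  by rewrite -[X in is_derive _ _ _ X]mulr1; exact: (@is_deriveZ _ _ _ id t).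
have dphi (r : R) : 0 <= r <= 1 ->
    is_derive r 1 phi ('D_e f (x + (t * r) *: e) * t).
  move=> /andP[r0 r1].
  have tr : `|t * r| <= `|t| by rewrite normrM ler_piMr// ger0_norm.
  exact: (is_derive1_comp (dline _ tr) (dmul r)).
have dphi' (r : R) : r \in `]0, 1[ ->
    is_derive r 1 phi ('D_e f (x + (t * r) *: e) * t).
  by rewrite in_itv/= => /andP[r0 r1]; apply: dphi; rewrite !ltW.
have cphi : {within `[0, 1], continuous phi}.
  by apply: derivable_within_continuous => r; rewrite in_itv/= => /dphi[].
have [r] := MVT ltr01 dphi' cphi.
rewrite in_itv/= => /andP[r0 r1].
rewrite /phi mulr1 mulr0 scale0r addr0 subr0 mulr1 => E.
exists (t * r); last by rewrite E mulrC.
by rewrite normrM ler_piMr// ger0_norm ?ltW.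
Qed.

(** The increment of f from u to u + h is split into n steps, each along one
    coordinate; by the mean value theorem and the continuity of the partial
    derivatives, each step is linear up to e |h| / (n + 1). *)
Lemma C1_differentiable (U : set 'rV[R]_n) f u :
  open U -> Ck 1 U f -> U u -> differentiable (f : 'rV[R]_n -> R^o) u.
Proof.
move=> Uo [_ f1] Uu.
have nU : nbhs u U by apply: open_nbhs_nbhs.
pose V : normedModType R := 'rV[R]_n.
pose W : normedModType R := R^o.
pose df (h : V) : W := \sum_i h ord0 i * partial i f u.
have lin_df : linear df.
  move=> a v1 v2; rewrite /df scaler_sumr -big_split; apply: eq_bigr => i _ /=.
  by rewrite !mxE mulrDl -mulrA.
pose dfM := GRing.isLinear.Build _ _ _ _ _ lin_df.
pose dfL : {linear V -> W} := HB.pack df dfM.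
have cdf : continuous dfL.
  apply: continuous_big => [|i _]; first exact: add_continuous.
  move=> x; have := @coord_continuous R 1 n ord0 i x.
  by move=> cx; apply: (@cvgMr_tmp R _ (nbhs x) _ (fun v : 'rV[R]_n => v ord0 i) _ _ cx).
pose F : V -> W := f.
suff E : F \o shift (u : V) = cst (F u) + (dfL : V -> W) +o_ (0 : V) id.
  apply/diff_locallyP; rewrite (diff_unique cdf E); split => //.
apply/eqaddoP => e e0.
have e1 : 0 < e / n.+1%:R by rewrite divr_gt0.
have near_partial (i : 'I_n) :
    \forall v \near u, `|partial i f v - partial i f u| <= e / n.+1%:R.
  have [_ [/(_ u Uu) /cvgrPdist_le /(_ _ e1) + _]] := f1 i.
  by apply: filterS => v; rewrite distrC.
have [d /= d0 Hd] := (nbhs_ballP _ _).1 (filterI nU (filter_forall _ near_partial)).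
have : \forall h \near (0 : 'rV[R]_n), `|h| < d.
  apply/nbhs_ballP; exists d => //= h.
  by rewrite -ball_normE /= sub0r normrN.
apply: filterS => h hd /=.
rewrite !fctE /=.
(* The first k coordinates of h, followed by zeros. *)
pose hk (k : nat) : 'rV[R]_n := \row_j (if (j < k)%N then h ord0 j else 0).
have hj j : `|h ord0 j| <= `|h|.
  by move: (lexx `|h|); rewrite {1}[`|h|]mx_normrE => /bigmax_leP[_ /(_ (ord0, j) isT)].
have bnd (z : 'rV[R]_n) : (forall j, `|z ord0 j| <= `|h|) -> `|z| <= `|h|.
  move=> zh; rewrite [leLHS]mx_normrE; apply/bigmax_leP; split => // -[i j] _ /=.
  by rewrite (ord1 i).
have hkS (k : 'I_n) : hk k.+1 = hk k + h ord0 k *: delta_mx ord0 k.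
  apply/rowP => j; rewrite !mxE eqxx/= ltnS leq_eqVlt.
  have [->|jk] := eqVneq j k; first by rewrite eqxx ltnn/= mulr1 add0r.
  by rewrite (negbTE (jk : (j : nat) != k))/= mulr0 addr0.
have step (k : 'I_n) :
    `|f (u + hk k.+1) - f (u + hk k) - h ord0 k * partial k f u|
    <= e / n.+1%:R * `|h|.
  have Bk (s : R) : `|s| <= `|h ord0 k| ->
      ball u d (u + hk k + s *: delta_mx ord0 k).
    move=> sk; rewrite -ball_normE /=.
    rewrite -addrA opprD addNKr normrN; apply: le_lt_trans hd; apply: bnd => j.
    rewrite !mxE eqxx/=; have [->|jk] := eqVneq j k.
      by rewrite ltnn add0r mulr1 (le_trans sk).
    by rewrite mulr0 addr0; case: ifP; rewrite ?normr0.
  have [s sk] : exists2 s : R, `|s| <= `|h ord0 k| &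
      f (u + hk k + h ord0 k *: delta_mx ord0 k) - f (u + hk k) =
      h ord0 k * 'D_(delta_mx ord0 k) f (u + hk k + s *: delta_mx ord0 k).
    apply: MVT_line => s sk; have [Us _] := Hd _ (Bk s sk).
    by have [/(_ _ Us)] := f1 k.
  rewrite hkS addrA => ->.
  have [_ /(_ k)] := Hd _ (Bk s sk).
  move=> H; rewrite -mulrBr normrM [leLHS]mulrC.
  exact: ler_pM.
have tel : f (u + h) - f u = \sum_(k < n) (f (u + hk k.+1) - f (u + hk k)).
  rewrite -(big_mkord xpredT (fun k => f (u + hk k.+1) - f (u + hk k))).
  rewrite telescope_sumr//; congr (f _ - f _).
    by congr (_ + _); apply/rowP => j; rewrite !mxE ltn_ord.
  by rewrite -[LHS]addr0; congr (_ + _); apply/rowP => j; rewrite !mxE.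
rewrite [h + u]addrC.
have -> : f (u + h) - (f u + df h) =
    \sum_(k < n) (f (u + hk k.+1) - f (u + hk k) - h ord0 k * partial k f u).
  by rewrite sumrB -tel /df opprD addrA.
apply: le_trans (ler_norm_sum _ _ _) _.
apply: le_trans (ler_sum _ (fun k _ => step k)) _.
rewrite sumr_const card_ord -[leLHS]mulr_natl mulrA ler_wpM2r//.
rewrite mulrCA; apply: ler_piMr; first exact: ltW.
by rewrite ler_pdivrMr// mul1r ler_nat.
Unshelve. all: by end_near. Qed.

End C1_differentiable.

Section riemannian_gradient.
Context {R : realType} {n : nat} (M : riemannian_manifold R n).
Implicit Types (f h : M -> R) (y : M).

Lemma C1_differentiable_at f y : C1 f -> differentiable_at f y.
Proof.
move=> /(_ (chart_at y)) f1.
apply: C1_differentiable f1 _; first exact: chart_image_open.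
by exists y => //; exact: chart_at_dom.
Qed.

Lemma differentiable_atB f h y : differentiable_at f y -> differentiable_at h y ->
  differentiable_at (fun z => f z - h z) y.
Proof. exact: differentiableB. Qed.

Lemma gradientD f h y : differentiable_at f y -> differentiable_at h y ->
  gradient (fun z => f z + h z) y = gradient f y + gradient h y.
Proof.
move=> df dh; rewrite /gradient -mulmxDl; congr (_ *m _).
apply/rowP => i; rewrite !mxE /partial.
by apply: deriveD; exact: diff_derivable.
Qed.

Lemma metric_tensorE y (u v : 'rV[R]_n) :
  metric_tensor y u v = \sum_i u ord0 i * (gram (chart_at y) y *m v^T) i ord0.
Proof. by rewrite /metric_tensor -mulmxA mxE. Qed.

End riemannian_gradient.

(** * The support of a Borel probability on a Polish space *)

Section support.
Context {R : realType} {X : ptopologicalType}.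

Lemma open_measurable_borel (U : set X) : open U ->
  measurable (U : set (borel X)).
Proof. by move=> oU; apply: sub_sigma_algebra. Qed.

(** The complement of the support is covered by the null balls with
    centre in a countable dense set and radius the inverse of a positive
    integer. *)
Lemma ae_supp (rho : probability (borel X) R) : polish_space R X ->
  {ae rho, forall x : borel X, supp rho x}.
Proof.
move=> [[D cD dD] [d [d0 dC dT nE _]]].
have dxx x : d x x = 0 by apply/d0.
pose Bq (q : X) (m : nat) : set X := [set y | d q y < m.+1%:R^-1].
have Bo q m : open (Bq q m).
  rewrite openE => y yB; rewrite /interior nE.
  exists (m.+1%:R^-1 - d q y) => /=; first by rewrite subr_gt0.
  move=> y' /= yy'; apply: le_lt_trans (dT q y y') _.
  by rewrite -ltrBrDl.
have /pcard_injP [i iinj] := cD.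
(* The null ball of radius 1/(m+1) around the point of D with index n, if any. *)
pose N (n m : nat) : set X :=
  [set y | exists q, [/\ D q, i q = n, rho (Bq q m) = 0%E & Bq q m y]].
have Nneg n m : rho.-negligible (N n m : set (borel X)).
  have [[q [Dq iq rq]]|nq] := pselect (exists q, [/\ D q, i q = n & rho (Bq q m) = 0%E]).
    exists (Bq q m); split => //; first exact: open_measurable_borel.
    move=> y [q' [Dq' iq' _ +]].
    by have -> : q' = q by apply: iinj; rewrite ?inE// iq iq'.
  exists set0; split => // y [q [Dq iq rq _]].
  by apply: nq; exists q.
have UN : rho.-negligible (\bigcup_n \bigcup_m (N n m : set (borel X))).
  apply: negligible_bigcup => n; exact: negligible_bigcup.
apply: negligibleS UN => x /= nsx.
have [U [oU Ux rU]] : exists U : set X, [/\ open U, U x & rho U = 0%E].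
  apply: contrapT => H; apply: nsx => U oU Ux.
  rewrite lt0e measure_ge0 andbT; apply/eqP => rU.
  by apply: H; exists U.
have : nbhs x U by exact: open_nbhs_nbhs.
rewrite nE => -[e /= e0 eU].
have [m me] : exists m : nat, m.+1%:R^-1 < e / 2.
  have e2 : 0 < e / 2 by rewrite divr_gt0.
  have [m _ Hm] := near_infty_natSinv_lt (PosNum e2).
  by exists m; apply: Hm => /=.
have [q [Bxq Dq]] : Bq x m `&` D !=set0.
  by apply: dD => //; exists x; rewrite /Bq /= dxx invr_gt0.
have Bqx : Bq q m x by rewrite /Bq /= dC.
exists (i q) => //; exists m => //; exists q; split => //.
apply/eqP; rewrite eq_le measure_ge0 andbT -rU.
apply: le_measure; rewrite ?inE; [exact: open_measurable_borel..|].
move=> y qy; apply: eU => /=.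
apply: le_lt_trans (dT x q y) _.
rewrite [ltRHS]splitr; apply: ltrD; exact: lt_trans me.
Qed.

End support.

(** * Gibbs densities *)

Section gibbs.
Context {R : realType} {d1 d2 : measure_display}.
Context {X : measurableType d1} {Y : measurableType d2}.
Variables (c : X -> Y -> R) (eps : R).
Variables (rho : probability X R) (nu : probability Y R).
Variables (p : probability (X * Y)%type R) (phi : X -> \bar R) (psi : Y -> \bar R).
Hypotheses (mc : measurable_fun setT (fun a : X * Y => c a.1 a.2)) (eps0 : 0 < eps).
Hypothesis cp : coupling rho nu p.
Hypothesis pot : entropic_potentials c eps rho nu p phi psi.
Local Open Scope ereal_scope.

Definition gibbs (u : X * Y) : R := fine (gibbs_density c eps phi psi u.1 u.2).

Let phiNy x : phi x != -oo. Proof. by case: pot => -[]. Qed.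
Let psiNy y : psi y != -oo. Proof. by case: pot => -[]. Qed.

(** The potentials avoid the value -oo, so the exponent is never +oo. *)
Lemma gibbsE u : (gibbs u)%:E = gibbs_density c eps phi psi u.1 u.2.
Proof.
rewrite /gibbs /gibbs_density.
have := phiNy u.1; have := psiNy u.2.
case: (phi u.1) => [f| |]//; case: (psi u.2) => [q| |]// _ _ /=.
- by rewrite gt0_mulye ?lte_fin ?invr_gt0.
- by rewrite gt0_mulye ?lte_fin ?invr_gt0.
- by rewrite gt0_mulye ?lte_fin ?invr_gt0.
Qed.

Lemma gibbs_ge0 u : (0 <= gibbs u)%R.
Proof. by rewrite -lee_fin gibbsE expeR_ge0. Qed.

Lemma gibbs_fin x y : phi x \is a fin_num -> psi y \is a fin_num ->
  gibbs (x, y) = expR (- ((c x y + fine (phi x) + fine (psi y)) / eps)).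
Proof.
rewrite /gibbs /gibbs_density /=.
by case: (phi x) => [f| |]//; case: (psi y) => [q| |].
Qed.

Lemma gibbs_phiy x y : phi x = +oo -> gibbs (x, y) = 0%R.
Proof.
rewrite /gibbs /gibbs_density /= => ->.
have := psiNy y; case: (psi y) => [q| |]// _;
  by rewrite /= gt0_mulye ?lte_fin ?invr_gt0.
Qed.

Lemma gibbs_psiy x y : psi y = +oo -> gibbs (x, y) = 0%R.
Proof.
rewrite /gibbs /gibbs_density /= => ->.
have := phiNy x; case: (phi x) => [q| |]// _;
  by rewrite /= gt0_mulye ?lte_fin ?invr_gt0.
Qed.

Lemma measurable_gibbs : measurable_fun setT gibbs.
Proof.
have [[mphi mpsi _ _] _ _ _ _] := pot.
apply: measurableT_comp => //; apply: measurableT_comp; first exact: measurable_expeR.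
apply: measurableT_comp => //.
apply: (@emeasurable_funM _ _ _ setT _ (cst (eps^-1)%:E)) => //.
apply: emeasurable_funD; last exact: measurableT_comp.
apply: emeasurable_funD; last exact: measurableT_comp.
exact/measurable_EFinP.
Qed.

Lemma plan_density A : measurable A ->
  p A = \int[rho \x nu]_(u in A) (gibbs u)%:E.
Proof.
move=> mA; have [_ prn dE _ _] := pot.
transitivity (\int[rho \x nu]_(u in A) density p (rho \x nu) u).
  exact: density_integral.
apply: ae_eq_integral => //.
- apply: measurable_funTS; exact: measurable_int (Radon_Nikodym_integrable _).
- apply: measurable_funTS; apply/measurable_EFinP; exact: measurable_gibbs.
- by apply: filterS dE => u uE _; rewrite gibbsE -uE.
Qed.

(** The Gibbs density vanishes where a potential is infinite, so a plan with this
    density gives no mass to such points. *)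
Lemma ae_phi_fin : {ae rho, forall x, phi x \is a fin_num}.
Proof.
have [[mphi _ _ _] _ _ _ _] := pot.
pose A := phi @^-1` [set +oo].
have mA : measurable A by rewrite -[A]setTI; exact: mphi.
exists A; split => //.
- transitivity (p (A `*` setT)); first by case: cp => + _ => ->.
  rewrite plan_density; last exact: measurableX.
  apply: integral0_eq => -[x y] [/= Ax _]; congr EFin.
  exact: gibbs_phiy.
- move=> x /= /negP; rewrite fin_numE negb_and !negbK => /orP[/eqP E|/eqP//].
  by have := phiNy x; rewrite E.
Qed.

Lemma ae_psi_fin : {ae nu, forall y, psi y \is a fin_num}.
Proof.
have [[_ mpsi _ _] _ _ _ _] := pot.
pose A := psi @^-1` [set +oo].
have mA : measurable A by rewrite -[A]setTI; exact: mpsi.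
exists A; split => //.
- transitivity (p (setT `*` A)); first by case: cp => _ ->.
  rewrite plan_density; last exact: measurableX.
  apply: integral0_eq => -[x y] [/= _ Ay]; congr EFin.
  exact: gibbs_psiy.
- move=> x /= /negP; rewrite fin_numE negb_and !negbK => /orP[/eqP E|/eqP//].
  by have := psiNy x; rewrite E.
Qed.

(** This is the Schroedinger equation for psi at y, exponentiated. *)
Lemma gibbs_cond_mass y : psi y \is a fin_num ->
  \int[rho]_x (gibbs (x, y))%:E = 1.
Proof.
move=> yfin; have [[mphi _ _ _] _ _ _ psiE] := pot.
pose J x := expeR (- (((c x y)%:E + phi x) * (eps^-1)%:E)).
have mJ : measurable_fun setT J.
  apply: measurableT_comp; first exact: measurable_expeR.
  apply: measurableT_comp => //.
  apply: (@emeasurable_funM _ _ _ setT _ (cst (eps^-1)%:E)) => //.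
  apply: emeasurable_funD => //; apply/measurable_EFinP.
  exact: (measurableT_comp mc (pair2_measurable y)).
have J0 x : 0 <= J x by exact: expeR_ge0.
have gE x : (gibbs (x, y))%:E = (expR (- (fine (psi y) / eps)))%:E * J x.
  rewrite gibbsE /gibbs_density /J /= -[in LHS](fineK yfin).
  have -> : (expR (- (fine (psi y) / eps)))%:E = expeR (- (fine (psi y) / eps))%:E by [].
  rewrite -expeRD; congr expeR.
  have := phiNy x; case: (phi x) => [f _| |]//.
    transitivity (- ((c x y + f + fine (psi y)) / eps))%:E; first by [].
    transitivity (- (fine (psi y) / eps) + - ((c x y + f) / eps))%:E; last by [].
    by congr EFin; rewrite [LHS](congr1 -%R (mulrDl _ _ _)) opprD addrC.
  by rewrite /= !gt0_mulye ?lte_fin ?invr_gt0.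
under eq_integral => x _ do rewrite gE.
rewrite ge0_integralZl ?lee_fin ?expR_ge0//.
move: (psiE y); rewrite -/J => psiyE.
have I0 : 0 <= \int[rho]_x J x by exact: integral_ge0.
case EI : (\int[rho]_x J x) I0 => [r| |] // I0; last first.
  by move: psiyE; rewrite EI /= gt0_muley ?lte_fin// => E; rewrite E in yfin.
move: psiyE; rewrite EI /=; case: ifPn => r0.
  by rewrite gt0_muleNy ?lte_fin// => E; rewrite E in yfin.
rewrite -ltNge in r0 => ->; rewrite -EFinM /=; congr EFin.
by rewrite mulrAC divff ?gt_eqF// mul1r expRN lnK ?posrE// mulVf ?gt_eqF.
Qed.

End gibbs.

(** * Entropic stability *)

Theorem mainTheorem2 (R : realType) (X : ptopologicalType) (n : nat)
    (Y : riemannian_manifold R n)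
    (rho : probability (borel X) R) (nu mu : probability (borel Y) R)
    (c : X -> Y -> R) (eps : R)
    (pi_nu pi_mu : probability (borel X * borel Y)%type R)
    (phi_nu phi_mu : X -> \bar R) (psi_nu psi_mu : Y -> \bar R)
    (L : R) (w : Y -> Y -> R) :
  polish_space R X ->
  connected [set: Y] ->
  geodesically_connected Y ->
  measurable_fun setT (fun a : borel X * borel Y => c a.1 a.2) ->
  0 < eps ->
  unique_eot_plan (X := borel X) (Y := borel Y) c eps rho nu pi_nu ->
  entropic_potentials (X := borel X) (Y := borel Y) c eps rho nu pi_nu phi_nu psi_nu ->
  unique_eot_plan (X := borel X) (Y := borel Y) c eps rho mu pi_mu ->
  entropic_potentials (X := borel X) (Y := borel Y) c eps rho mu pi_mu phi_mu psi_mu ->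
  (forall x, C1 (c x)) ->
  weak_gradient_formula c eps rho nu phi_nu psi_nu ->
  0 < L ->
  (forall z y, 0 <= w z y) ->
  (forall x, supp rho x -> exists f : Y -> R,
     (forall y, ((c x y)%:E + psi_nu y)%E = (f y)%:E) /\
     semiconcave L w f) ->
  (rel_entropy pi_mu pi_nu <=
   rel_entropy mu nu +
   (L / (2 * eps))%:E * transport_cost (T := borel Y) w mu nu)%E.
Proof.
move=> polX _ geoY mc eps0 [cPn _ _] potn [cPm _ _] potm cC1 wgrad L0 w0 semi.
set k := L / (2 * eps).
have k0 : 0 < k by rewrite divr_gt0// mulr_gt0.
have suppae := ae_supp rho polX.
have [x0 sx0] := ae_nonempty suppae.
have psi_fin y : psi_nu y \is a fin_num.
  have [f [/(_ y) + _]] := semi x0 sx0.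
  by case: (psi_nu y).
pose q y := fine (psi_nu y).
have fE x f : (forall y, ((c x y)%:E + psi_nu y)%E = (f y)%:E) ->
    f = (fun y => c x y + q y).
  move=> Hf; apply/funext => y; have := Hf y.
  by rewrite -(fineK (psi_fin y)) => -[].
pose g : borel X * borel Y -> R :=
  gibbs (X := borel X) (Y := borel Y) c eps phi_nu psi_nu.
pose g' : borel X * borel Y -> R :=
  gibbs (X := borel X) (Y := borel Y) c eps phi_mu psi_mu.
have g0 : forall u, 0 <= g u := gibbs_ge0 eps0 potn.
have mg : measurable_fun setT g := measurable_gibbs mc potn.
have g'0 : forall u, 0 <= g' u := gibbs_ge0 eps0 potm.
have mg' : measurable_fun setT g' := measurable_gibbs mc potm.
have PE := plan_density mc eps0 potn.
have QE' := plan_density mc eps0 potm.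
have g1 y : (\int[rho]_x (g (x, y))%:E = 1)%E.
  exact: (gibbs_cond_mass mc eps0 potn (psi_fin y)).
(* s = a + b is the logarithm of the ratio of the two Gibbs densities. *)
pose a (x : borel X) := (fine (phi_nu x) - fine (phi_mu x)) / eps.
pose b (z : borel Y) := (fine (psi_nu z) - fine (psi_mu z)) / eps.
have [[mphin mpsin _ _] _ _ _ _] := potn.
have [[mphim mpsim _ _] _ _ _ _] := potm.
have ma : measurable_fun setT a.
  by apply: measurable_funM => //; apply: measurable_funB; exact: measurableT_comp.
have mb : measurable_fun setT b.
  by apply: measurable_funM => //; apply: measurable_funB; exact: measurableT_comp.
have gg' x z : phi_nu x \is a fin_num -> phi_mu x \is a fin_num ->
    psi_mu z \is a fin_num -> expR (a x + b z) * g (x, z) = g' (x, z).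
  move=> h1 h2 h3; rewrite /g /g' !gibbs_fin// -expRD; congr expR.
  rewrite /a /b -mulrDl -mulNr -mulrDl -[RHS]mulNr; congr (_ / _); lra.
have phin := ae_phi_fin mc eps0 cPn potn.
have phim := ae_phi_fin mc eps0 cPm potm.
have psim := ae_psi_fin mc eps0 cPm potm.
have mexp : measurable_fun setT
    (fun u : borel X * borel Y => expR (a u.1 + b u.2) * g u).
  apply: measurable_funM => //; apply: measurableT_comp => //.
  by apply: measurable_funD; exact: measurableT_comp.
have QE A : measurable A -> pi_mu A =
    (\int[rho \x mu]_(u in A) (expR (a u.1 + b u.2) * g u)%:E)%E.
  move=> mA; rewrite QE'//.
  have cp := coupling_product rho mu.
  apply: ae_eq_integral => //.
  - apply: measurable_funTS; exact/measurable_EFinP.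
  - apply: measurable_funTS; exact/measurable_EFinP.
  - apply: filterS (filterI (coupling_ae1 cp (filterI phin phim)) (coupling_ae2 cp psim)).
    by move=> -[x z] /= [[h1 h2] h3] _; rewrite gg'.
have g2 : {ae mu, forall z,
    (\int[rho]_x (expR (a x + b z) * g (x, z))%:E = 1)%E}.
  apply: filterS psim => z h3.
  rewrite -(gibbs_cond_mass mc eps0 potm h3); apply: ae_eq_integral => //.
  - apply/measurable_EFinP; exact: (measurableT_comp mexp (pair2_measurable z)).
  - apply/measurable_EFinP; exact: (measurableT_comp mg' (pair2_measurable z)).
  - by apply: filterS (filterI phin phim) => x [h1 h2] _; rewrite gg'.
have dual : {ae nu, forall y : borel Y, forall (al : borel X -> R) (B : R),
    measurable_fun setT al -> (forall x, 0 <= al x <= B) ->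
    forall z, (\int[rho]_x (al x * g (x, y))%:E <=
     (log_mgf rho g al z)%:E + (k * w z y)%:E)%E}.
  have [G [_ Gq Gae]] := wgrad.
  apply: filterS Gae => y [intgrad GyE] al B mal alB z.
  (* A geodesic from y to z, along which semiconcavity at y is used. *)
  have [ga [geo ga0 ga1]] := geoY y z.
  set v := initial_velocity ga.
  (* psi_nu is the difference of a semiconcave function and a C^1 function. *)
  have dq : differentiable_at q y.
    have [f [/fE Hf [df _]]] := semi x0 sx0.
    have -> : q = (fun z => f z - c x0 z).
      by apply/funext => t; rewrite Hf addrC addKr.
    by apply: differentiable_atB; [exact: df|exact: C1_differentiable_at].
  have Gqy : gradient q y = - cond_mean_gradient c eps rho phi_nu psi_nu y.
    by rewrite -GyE Gq.
  pose cf i := (gram (chart_at y) y *m v^T) i ord0.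
  pose K := eps^-1 * metric_tensor y (gradient q y) v + k * w z y.
  (* La x is the semiconcavity bound for the increment of c(x,.) + psi_nu from y to
     z, divided by eps. *)
  pose La (x : borel X) := \sum_i (eps^-1 * cf i) * gradient (c x) y ord0 i + K.
  have intg : rho.-integrable setT (fun x => (g (x, y))%:E).
    apply/integrableP; split.
      by apply/measurable_EFinP; exact: (measurableT_comp mg (pair2_measurable y)).
    under eq_integral => x _ do rewrite gee0_abs ?lee_fin//.
    by rewrite g1 ltry.
  have [intLa ELa] := integrable_affine (fun i => eps^-1 * cf i) K intgrad intg.
  have LaE x : La x * g (x, y) = \sum_i (eps^-1 * cf i) *
      (gradient (c x) y ord0 i * cond_density c eps phi_nu psi_nu y x) + K * g (x, y).
    by rewrite mulrDl mulr_suml; congr (_ + _); apply: eq_bigr => i _; rewrite mulrA.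
  (* The mean of La under the conditional law at y is k w(z,y): the gradient terms
     cancel by the formula for the gradient of psi_nu. *)
  have kapE : \sum_i (eps^-1 * cf i) * \int[rho]_x
        (gradient (c x) y ord0 i * cond_density c eps phi_nu psi_nu y x) +
      K * \int[rho]_x g (x, y) = k * w z y.
    rewrite [X in K * X](_ : _ = 1); last by rewrite /Rintegral g1.
    rewrite mulr1 /K metric_tensorE Gqy mulr_sumr addrA -big_split/=.
    rewrite big1 ?add0r// => i _.
    by rewrite -/(cf i) [X in X * cf i]mxE [X in - X]mxE; ring.
  rewrite -EFinD; apply: (@jensen_log_mgf _ _ _ _ _ rho g g0 mg g1 al B y z La) => //.
  - by under eq_fun do rewrite LaE.
  - by under eq_integral => x _ do rewrite LaE; rewrite ELa kapE.
  have [N [mN N0 subN]] := suppae; exists N; split => //.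
  apply: subset_trans subN; apply: subsetC => x sx /=.
  have [hx|hx] := boolP (phi_nu x \is a fin_num); last first.
    have xy : phi_nu x = +oo%E.
      move: hx; rewrite fin_numE negb_and !negbK => /orP[/eqP E|/eqP//].
      by have [[_ _ /(_ x)]] := potn; rewrite E.
    by rewrite /g !(gibbs_phiy eps0 potn _ xy) mulr0.
  rewrite /g !gibbs_fin// -expRD ler_expR.
  have [f [/fE Hf [_ /(_ z y ga geo ga0 ga1)]]] := semi x sx.
  rewrite -/v Hf gradientD//; last exact: C1_differentiable_at.
  set S := metric_tensor y _ v => H.
  have LaS : La x = eps^-1 * S + k * w z y.
    rewrite /La /K addrA; congr (_ + _).
    rewrite /S !metric_tensorE !mulr_sumr -big_split/=; apply: eq_bigr => i _.
    by rewrite -/(cf i) [in RHS]mxE; ring.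
  have kE : k = L / 2 * eps^-1 by rewrite /k invfM mulrA.
  have := ler_wpM2l (ltW (_ : 0 < eps^-1)) H.
  rewrite invr_gt0 => /(_ eps0) HE.
  rewrite LaS kE -/(q z) -/(q y); lra.
have sbound tau :=
  integral_log_density_le g0 mg ma mb cPn cPm PE QE g1 g2 k0 w0 dual (tau := tau).
set W := transport_cost _ _ _.
have [Woo|Woo] := eqVneq W +oo%E.
  by rewrite Woo gt0_muley ?lte_fin// addey ?leey// rel_entropy_neqNy.
have [_ [tau0 ct0 <-] wfin0] : exists2 y,
    [set \int[p]_a (w a.1 a.2)%:E | p in coupling mu nu]%E y & (y < +oo)%E.
  by apply: ereal_inf_lt; rewrite ltey.
have [ints _] := sbound tau0 ct0 wfin0.
apply: (le_trans (rel_entropy_chain_rule g0 mg ma mb cPm PE QE ints)).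
apply: leeD2l; rewrite -lee_pdivrMl//.
apply: le_ereal_inf_tmp => _ [tau ct <-]; rewrite lee_pdivrMl//.
have [->|wfin] := eqVneq (\int[tau]_a (w a.1 a.2)%:E)%E +oo%E.
  by rewrite gt0_muley ?lte_fin// leey.
by apply: (sbound tau ct _).2; rewrite ltey.
Qed.
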